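(* Let $c>0$, $\alpha\in(0,2]$, $\beta\in[-1,1]$, let $\phi_{c,\alpha,\beta}$ be the reference stable law, let $(t_n)_{n\in\mathbb N}$ be a sequence growing to infinity, and let $(X_n)_{n\in\mathbb N}$ be a sequence of real random variables with a zone of control $[-K(t_n)^\gamma,K(t_n)^\gamma]$ of index $(v,w)$, with constants $K_1,K_2$. Let $Y$ have law $\phi_{c,\alpha,\beta}$, and let $Y_n=X_n/(t_n)^{1/\alpha}$ if $\alpha\ne1$, $Y_n=\frac{X_n}{t_n}-\frac{2c\beta}{\pi}\log t_n$ if $\alpha=1$. (a) If $(f_n)_{n\in\mathbb N}$ is a sequence of smooth test functions in $\mathscr T_0(\mathbb R)$ such that the support of $\widehat f_n$ is included in $[-K(t_n)^{\gamma+1/\alpha},K(t_n)^{\gamma+1/\alpha}]$, then $$|\mathbb E[f_n(Y_n)]-\mathbb E[f_n(Y)]|\le C_0(c,\alpha,v)\,K_1\,\frac{\|f_n\|_{L^1}}{(t_n)^{v/\alpha}},\qquad C_0(c,\alpha,v)=\frac{2^{\frac{v+1}{\alpha}}\,\Gamma((v+1)/\alpha)}{\pi\alpha\,c^{v+1}}.$$ (b) If instead $(f_n)_{n\in\mathbb N}$ is a sequence of smooth test distributions in $\mathscr T_1(\mathbb R)$ such that, with $\phi_n=\partial f_n$ the derivative of the distribution $f_n$, the support of $\widehat\phi_n$ is included in $[-K(t_n)^{\gamma+1/\alpha},K(t_n)^{\gamma+1/\alpha}]$, then $$|\mathbb E[f_n(Y_n)]-\mathbb E[f_n(Y)]|\le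 C_1(c,\alpha,v)\,K_1\,\frac{\|\phi_n\|_{L^1}}{(t_n)^{v/\alpha}},\qquad C_1(c,\alpha,v)=\frac{2^{v/\alpha}\,\Gamma(v/\alpha)}{\pi\alpha\,c^{v}}.$$
   Context: Functions are complex-valued on $\mathbb R$; the Fourier transform of $f\in L^1(\mathbb R)$ is $\widehat f(\xi)=\int_{\mathbb R}e^{ix\xi}f(x)\,dx$. Test functions: $\mathscr T_0(\mathbb R)$ is the space of $f\in L^1(\mathbb R)$ whose Fourier transform is compactly supported (such $f$ are smooth). $\mathscr T_1(\mathbb R)$ is the space of tempered distributions $f$ whose distributional derivative $\partial f$ is represented by an element of $\mathscr T_0(\mathbb R)$; any such $f$ is represented by a bounded $C^\infty$ function, so that $\mathbb E[f(Y)]$ makes sense. Stable laws: $\phi_{c,\alpha,\beta}$ is the probability law on $\mathbb R$ with $\int e^{ix\xi}\phi_{c,\alpha,\beta}(dx)=e^{\eta_{c,\alpha,\beta}(i\xi)}$, where $\eta_{c,\alpha,\beta}(i\xi)=-|c\xi|^\alpha(1-i\beta\,h(\alpha,\xi)\,\mathrm{sgn}(\xi))$, $h(\alpha,\xi)=\tan(\frac{\pi\alpha}{2})$ if $\alpha\neq1$ and $h(1,\xi)=-\frac2\pi\log|\xi|$. Zone of control: let $(t_n)_{n\in\mathbb N}$ be a sequence growing to infinity, $v>0$, $w>0$ and $\gamma\in\mathbb R$. The sequence $(X_n)$ has a zone of control $[-K(t_n)^\gamma,K(t_n)^\gamma]$ of index $(v,w)$ (with respect to $\phi_{c,\alpha,\beta}$)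 if the following two conditions hold for some positive constants $K_1,K_2$ independent of $n$. (Z1) For all $n$ and all $\xi\in[-K(t_n)^\gamma,K(t_n)^\gamma]$, setting $\theta_n(\xi)=\mathbb E[e^{i\xi X_n}]\,e^{-t_n\eta_{c,\alpha,\beta}(i\xi)}$, one has $|\theta_n(\xi)-1|\le K_1|\xi|^v\exp(K_2|\xi|^w)$. (Z2) $\alpha\le w$, $-\frac1\alpha\le\gamma\le\frac1{w-\alpha}$, and $0<K\le\left(\frac{c^\alpha}{2K_2}\right)^{\frac1{w-\alpha}}$.
   Formalization: The terms t_n are assumed positive and the bounds in (a) and (b) are asserted for those n with t_n ≥ 1; for 0 < t_n < 1 the stated bound can fail, since (Z2) then no longer gives K_2|ξ|^w ≤ t_n|cξ|^α/2 on the zone. *)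

(* Defs.v *)
From HB Require Import structures.
From mathcomp Require Import all_boot all_order all_algebra.
From mathcomp Require Import all_classical all_reals all_analysis.

Set Implicit Arguments.
Unset Strict Implicit.
Unset Printing Implicit Defensive.

Import Order.TTheory GRing.Theory Num.Theory.
Import numFieldNormedType.Exports.
From mathcomp Require Import complex.
Import ComplexField.Normc.

Local Open Scope classical_set_scope.
Local Open Scope ring_scope.
Local Open Scope complex_scope.

(* The canonical norm of R[i] takes its values in R[i]; the R-valued modulus is
   normc. *)

Section ComplexFunctions.
Context {R : realType}.
Implicit Types (f g : R -> R[i]) (z : R[i]).

Definition cexp z : R[i] :=
  (expR (Re z) * cos (Im z)) +i* (expR (Re z) * sin (Im z)).

Definition cintegral d (T : measurableType d) (mu : {measure set T -> \bar R})
    (f : T -> R[i]) : R[i] :=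
  (\int[mu]_(x in setT) Re (f x))%R +i* (\int[mu]_(x in setT) Im (f x))%R.

Definition integrableC f : Prop :=
  (@lebesgue_measure R).-integrable setT (fun x => (Re (f x))%:E) /\
  (@lebesgue_measure R).-integrable setT (fun x => (Im (f x))%:E).

Definition L1norm f : R := (\int[@lebesgue_measure R]_(x in setT) normc (f x))%R.

Definition smooth f : Prop := forall (m : nat) (x : R),
  derivable (derive1n m (fun y : R => Re (f y)) : R -> R) x 1 /\
  derivable (derive1n m (fun y : R => Im (f y)) : R -> R) x 1.

Definition deriveC (m : nat) f : R -> R[i] := fun x =>
  derive1n m (fun y : R => Re (f y)) x +i* derive1n m (fun y : R => Im (f y)) x.

Definition boundedC f : Prop := exists M : R, forall x, normc (f x) <= M.

Definition fourier f : R -> R[i] := fun xi =>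
  cintegral (@lebesgue_measure R) (fun x => cexp ((x * xi)*i) * f x).

Definition csupport f : set R := closure [set x | f x != 0].

End ComplexFunctions.

Section TestFunctions.
Context {R : realType}.
Implicit Types (f g s : R -> R[i]) (T : (R -> R[i]) -> R[i]).

(* An L^1 class with compactly supported Fourier transform has a unique smooth
   representative; f is that representative, so that E[f(Z)] is meaningful for
   every real random variable Z. *)
Definition test_function f : Prop :=
  [/\ smooth f, integrableC f & compact (csupport (fourier f))].

Definition schwartz s : Prop :=
  smooth s /\
  forall k m : nat, exists M : R, forall x, `|x| ^+ k * normc (deriveC m s x) <= M.

Definition schwartz_seminorm (k m : nat) s : R :=
  sup (range (fun x : R => `|x| ^+ k * normc (deriveC m s x))).

(* A distribution is given by a functional on all of R -> R[i]; only its values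
   on the Schwartz space are relevant. *)
Definition tempered_distribution T : Prop :=
  (forall (a : R[i]) s1 s2, schwartz s1 -> schwartz s2 ->
     T (fun x => a * s1 x + s2 x) = a * T s1 + T s2) /\
  (exists (C : R) (N : nat), forall s, schwartz s ->
     normc (T s) <= C * \sum_(k < N) \sum_(m < N) schwartz_seminorm k m s).

Definition distr_derive T : (R -> R[i]) -> R[i] := fun s => - T (deriveC 1 s).

Definition represents g T : Prop := forall s, schwartz s ->
  T s = cintegral (@lebesgue_measure R) (fun x => g x * s x).

Definition test_distribution T : Prop :=
  tempered_distribution T /\
  exists2 phi, test_function phi & represents phi (distr_derive T).

End TestFunctions.

Section StableLaws.
Context {R : realType}.
Implicit Types c alpha beta xi : R.

Definition stable_h alpha xi : R :=
  if alpha == 1 then - (2 / pi) * ln `|xi| else tan (pi * alpha / 2).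

(* eta_{c,alpha,beta}(i xi), as a function of xi; at xi = 0 it is 0, since
   ln 0 = 0 and Num.sg 0 = 0. *)
Definition stable_exponent c alpha beta xi : R[i] :=
  - (`|c * xi| `^ alpha)%:C
  * (1 -i* (beta * stable_h alpha xi * Num.sg xi)).

Definition stable_law c alpha beta (mu : probability R R) : Prop :=
  forall xi : R, cintegral mu (fun x : R => cexp ((x * xi)*i))
                 = cexp (stable_exponent c alpha beta xi).

Definition Gamma (s : R) : R :=
  (\int[@lebesgue_measure R]_(x in `]0, +oo[) (x `^ (s - 1) * expR (- x)))%R.

End StableLaws.

Section ZoneOfControl.
Context {R : realType}.

Definition char_function d (Omega : measurableType d) (P : probability Omega R)
    (X : {RV P >-> R}) (xi : R) : R[i] :=
  cintegral P (fun o => cexp ((xi * X o)*i)).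

Context (c alpha beta : R) (t : nat -> R)
  (d : nat -> measure_display) (Omega : forall n, measurableType (d n))
  (P : forall n, probability (Omega n) R) (X : forall n, {RV (P n) >-> R}).

Definition theta (n : nat) (xi : R) : R[i] :=
  char_function (X n) xi * cexp (- (t n)%:C * stable_exponent c alpha beta xi).

(* The exponent 1 / (w - alpha) is +oo when w = alpha.  In that case the upper
   bound on gamma is void, and x ^ (+oo) is read as 0 if x < 1 and as +oo if
   x >= 1, so the upper bound on K (which is positive) amounts to
   1 <= c^alpha / (2 K2). *)
Record zone_of_control (v w gamma K K1 K2 : R) : Prop := ZoneOfControl {
  zone_K1_gt0 : 0 < K1;
  zone_K2_gt0 : 0 < K2;
  zone_theta : forall (n : nat) (xi : R),
    xi \in `[- (K * t n `^ gamma), K * t n `^ gamma] ->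
    normc (theta n xi - 1) <= K1 * `|xi| `^ v * expR (K2 * `|xi| `^ w);
  zone_alpha_le : alpha <= w;
  zone_gamma_ge : - (1 / alpha) <= gamma;
  zone_gamma_le : alpha < w -> gamma <= 1 / (w - alpha);
  zone_K_gt0 : 0 < K;
  zone_K_le : alpha < w -> K <= (c `^ alpha / (2 * K2)) `^ (1 / (w - alpha));
  zone_K2_le : w = alpha -> 1 <= c `^ alpha / (2 * K2)
}.

Definition normalized (n : nat) (o : Omega n) : R :=
  if alpha == 1 then X n o / t n - 2 * c * beta / pi * ln (t n)
  else X n o / t n `^ (1 / alpha).

End ZoneOfControl.

Section Constants.
Context {R : realType}.
Implicit Types c alpha v : R.

Definition C0 c alpha v : R :=
  2 `^ ((v + 1) / alpha) * Gamma ((v + 1) / alpha) / (pi * alpha * c `^ (v + 1)).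

Definition C1 c alpha v : R :=
  2 `^ (v / alpha) * Gamma (v / alpha) / (pi * alpha * c `^ v).

End Constants.

(* Main.v *)
(* The zone of control and the scaling of the stable exponent bound the difference of the
   characteristic functions of Y_n and Y by K1 t_n^(-v/alpha) |xi|^v exp(-|c xi|^alpha / 2)
   for |xi| <= r_n, and the constants C0 and C1 are Gamma integrals of this bound.  Fourier
   inversion is replaced by convolution with kernels k that are explicit (co)sine transforms of
   integrable weights m on the half-line: by Fubini, E[(g * k)(Y_n)] - E[(g * k)(Y)] is an
   integral over xi > 0 involving only m, the Fourier transform of g and the difference of
   characteristic functions.
   (a) For m = exp(- d xi) / pi, k is the Poisson kernel, and f * k tends to f as d -> 0.
   (b) For m = (exp(- a xi) - exp(- b xi)) / (pi xi), k z = (atan (b/z) - atan (a/z)) / pi tends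
   to sgn z / 2 as a -> 0 and b -> oo, so phi * k tends to a primitive of phi, which differs
   from f by a constant that cancels in the difference of expectations. *)
Require Import Defs.
From HB Require Import structures.
From mathcomp Require Import all_boot all_order all_algebra.
From mathcomp Require Import all_classical all_reals all_analysis.
From mathcomp Require Import measurable_realfun ring lra.

Set Implicit Arguments.
Unset Strict Implicit.
Unset Printing Implicit Defensive.

Import Order.TTheory GRing.Theory Num.Theory.
Import numFieldNormedType.Exports.
From mathcomp Require Import complex.
Import ComplexField.Normc.

Local Open Scope classical_set_scope.
Local Open Scope ring_scope.
Local Open Scope complex_scope.

(** * Complex-valued integration *)

(** Fourier inversion is the obstacle: an element of (a) is only known to be integrable, and in (b)
    [f] itself has no Fourier transform as a function. Since every weight [m] is integrable and [g]
    is integrable, the double integrals are dominated by a product and Fubini applies directly. The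
    estimate survives the limit because the weights are bounded uniformly in the regularisation, by
    [1 / pi] in (a) and by [1 / (pi * xi)] in (b); the extra factor [1 / xi] is why (b) has [v]
    where (a) has [v + 1]. The half in [exp (- |c xi|^alpha / 2)] comes from (Z2): for [t_n >= 1] it
    bounds the growth [K2 |xi|^w] allowed by (Z1) by half of the decay of the stable exponent. The
    substitution [u = (c xi)^alpha / 2] then produces the powers of 2 and of [c] and the factor
    [1 / alpha]. The factor [1 / pi] is twice the [1 / (2 pi)] of Fourier inversion, as the
    frequencies [xi] and [- xi] are folded onto the half-line. *)

Section ComplexModulus.
Context {R : realType}.
Implicit Types z w : R[i].

Lemma ReM z w : Re (z * w) = Re z * Re w - Im z * Im w.
Proof. by case: z => a b; case: w. Qed.

Lemma ImM z w : Im (z * w) = Re z * Im w + Im z * Re w.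
Proof. by case: z => a b; case: w. Qed.

Lemma complexP z w : Re z = Re w -> Im z = Im w -> z = w.
Proof. by case: z => a b; case: w => c d /= -> ->. Qed.

Lemma normcE z : normc z = Num.sqrt (Re z ^+ 2 + Im z ^+ 2).
Proof. by case: z. Qed.

Lemma normc_ge0 z : 0 <= normc z.
Proof. by rewrite normcE sqrtr_ge0. Qed.

Lemma sqr_normc z : normc z ^+ 2 = Re z ^+ 2 + Im z ^+ 2.
Proof. by rewrite normcE sqr_sqrtr// addr_ge0 ?sqr_ge0. Qed.

Lemma normr_Re_le z : `|Re z| <= normc z.
Proof.
by rewrite normcE -sqrtr_sqr ler_wsqrtr// lerDl sqr_ge0.
Qed.

Lemma normr_Im_le z : `|Im z| <= normc z.
Proof.
by rewrite normcE -sqrtr_sqr ler_wsqrtr// lerDr sqr_ge0.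
Qed.

Lemma normc_le_ReIm z : normc z <= `|Re z| + `|Im z|.
Proof.
rewrite -(ler_pXn2r (ltn0Sn 1)) ?nnegrE ?normc_ge0 ?addr_ge0//.
rewrite sqr_normc sqrrD !real_normK ?num_real// lerD2r lerDl.
by rewrite mulrn_wge0 ?mulr_ge0.
Qed.

Lemma normc_real (x : R) : normc x%:C = `|x|.
Proof. by rewrite normcE /= expr0n addr0 sqrtr_sqr. Qed.

Lemma normc_cexp z : normc (cexp z) = expR (Re z).
Proof.
rewrite normcE /= !exprMn -mulrDr cos2Dsin2 mulr1 sqrtr_sqr ger0_norm//.
Qed.

Lemma cexpD z w : cexp (z + w) = cexp z * cexp w.
Proof.
case: z => a b; case: w => c d; apply: complexP; rewrite ?ReM ?ImM /=.
  by rewrite expRD cosD; ring.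
by rewrite expRD sinD; ring.
Qed.

Lemma cexp0 : cexp 0 = 1 :> R[i].
Proof. by rewrite /cexp /= expR0 cos0 sin0 mulr1 mulr0. Qed.

Lemma normc_cexpi (x : R) : normc (cexp (x*i)) = 1.
Proof. by rewrite normc_cexp /= expR0. Qed.

Lemma Re_cexpi (x : R) : Re (cexp (x*i)) = cos x.
Proof. by rewrite /= expR0 mul1r. Qed.

Lemma Im_cexpi (x : R) : Im (cexp (x*i)) = sin x.
Proof. by rewrite /= expR0 mul1r. Qed.

Lemma cexpiD (x y : R) : cexp ((x + y)*i) = cexp (x*i) * cexp (y*i) :> R[i].
Proof. by rewrite -cexpD; congr cexp; apply: complexP => /=; rewrite ?addr0. Qed.

Lemma normc_triangle z w : normc (z + w) <= normc z + normc w.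
Proof. exact: le_normcD. Qed.

(** The left side is the real part of the product of the conjugate of [z] with [w], and that product
    has modulus [normc z * normc w]. *)
Lemma cauchy_schwarz_complex z w :
  Re z * Re w + Im z * Im w <= normc z * normc w.
Proof.
rewrite -normcM (le_trans (ler_norm _))//.
have -> : normc (z * w) = normc ((z^*)%C * w).
  by rewrite !normcM; congr (_ * _); rewrite !normcE; case: z => a b /=; rewrite sqrrN.
apply: le_trans (normr_Re_le _).
by rewrite ReM; case: z => a b /=; rewrite mulNr opprK.
Qed.

End ComplexModulus.

Section ComplexIntegral.
Context {R : realType}.

Definition cmeasurable d (T : measurableType d) (f : T -> R[i]) : Prop :=
  measurable_fun setT (fun x => Re (f x)) /\
  measurable_fun setT (fun x => Im (f x)).

(** Extends [integrableC] to an arbitrary measure; for Lebesgue measure the two unfold to the same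
    proposition, so hypotheses on test functions apply as they are. *)
Definition cintegrable d (T : measurableType d) (mu : {measure set T -> \bar R})
    (f : T -> R[i]) : Prop :=
  mu.-integrable setT (fun x => (Re (f x))%:E) /\
  mu.-integrable setT (fun x => (Im (f x))%:E).

Section one_measure.
Context d (T : measurableType d) (mu : {measure set T -> \bar R}).
Implicit Types f g : T -> R[i].

Lemma cmeasurableM f g : cmeasurable f -> cmeasurable g ->
  cmeasurable (fun x => f x * g x).
Proof.
move=> [f1 f2] [g1 g2]; split.
  by under eq_fun do rewrite ReM; apply: measurable_funB; apply: measurable_funM.
by under eq_fun do rewrite ImM; apply: measurable_funD; apply: measurable_funM.
Qed.

Lemma cmeasurableD f g : cmeasurable f -> cmeasurable g ->
  cmeasurable (fun x => f x + g x).
Proof.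
move=> [f1 f2] [g1 g2]; split; under eq_fun do rewrite raddfD /=;
  exact: measurable_funD.
Qed.

Lemma cmeasurable_cst (z : R[i]) : cmeasurable (fun _ : T => z).
Proof. by split; exact: measurable_cst. Qed.

Lemma cmeasurable_real (r : T -> R) : measurable_fun setT r ->
  cmeasurable (fun x => (r x)%:C).
Proof. by move=> mr; split => //=; exact: measurable_cst. Qed.

Lemma cmeasurable_cexpi (r : T -> R) : measurable_fun setT r ->
  cmeasurable (fun x => cexp ((r x)*i)).
Proof.
move=> mr; split.
  under eq_fun do rewrite Re_cexpi.
  apply: (@measurableT_comp _ _ _ _ _ _ (@cos R)) => //.
  by apply: continuous_measurable_fun; exact: continuous_cos.
under eq_fun do rewrite Im_cexpi.
apply: (@measurableT_comp _ _ _ _ _ _ (@sin R)) => //.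
  by apply: continuous_measurable_fun; exact: continuous_sin.
Qed.

Lemma measurable_normc f : cmeasurable f ->
  measurable_fun setT (fun x => normc (f x)).
Proof.
move=> [f1 f2]; under eq_fun do rewrite normcE.
apply: (@measurableT_comp _ _ _ _ _ _ (@Num.sqrt R)); last first.
  by apply: measurable_funD; apply: measurable_funX.
by apply: continuous_measurable_fun; exact: sqrt_continuous.
Qed.

Lemma integrable_dominated (f g : T -> R) : measurable_fun setT f ->
  (forall x, `|f x| <= g x) -> mu.-integrable setT (EFin \o g) ->
  mu.-integrable setT (EFin \o f).
Proof.
move=> mf fg ig; apply: le_integrable ig => //; first exact/measurable_EFinP.
by move=> x _ /=; rewrite lee_fin (le_trans (fg x))// ler_norm.
Qed.

Lemma integrable_mulr (r : R) (h : T -> R) : mu.-integrable setT (EFin \o h) ->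
  mu.-integrable setT (EFin \o (fun x => r * h x)).
Proof. by move=> hi; exact: (integrableZl measurableT r hi). Qed.

Lemma cintegrable_dominated f (g : T -> R) : cmeasurable f ->
  (forall x, normc (f x) <= g x) -> mu.-integrable setT (EFin \o g) ->
  cintegrable mu f.
Proof.
move=> [f1 f2] fg ig; split; apply: (integrable_dominated _ _ ig) => // x.
  by rewrite (le_trans (normr_Re_le _)).
by rewrite (le_trans (normr_Im_le _)).
Qed.

Lemma cintegrable_cmeasurable f : cintegrable mu f -> cmeasurable f.
Proof.
by move=> [f1 f2]; split; apply/measurable_EFinP; [exact: (measurable_int _ f1)|
  exact: (measurable_int _ f2)].
Qed.

Lemma integrable_normc f : cintegrable mu f ->
  mu.-integrable setT (fun x => (normc (f x))%:E).
Proof.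
move=> fi; have [f1 f2] := fi.
apply: (@integrable_dominated _ (fun x => `|Re (f x)| + `|Im (f x)|)).
- exact: measurable_normc (cintegrable_cmeasurable fi).
- by move=> x; rewrite ger0_norm ?normc_ge0// normc_le_ReIm.
- rewrite (_ : _ \o _ = (fun x => `|Re (f x)|%:E) \+ (fun x => `|Im (f x)|%:E))%E//.
  by apply: integrableD => //; exact: integrable_norm.
Qed.

Lemma cintegrableD f g : cintegrable mu f -> cintegrable mu g ->
  cintegrable mu (fun x => f x + g x).
Proof.
move=> fi gi.
have H := integrableD measurableT (integrable_normc fi) (integrable_normc gi).
apply: (@cintegrable_dominated _ (fun x => normc (f x) + normc (g x))).
- by apply: cmeasurableD; exact: cintegrable_cmeasurable.
- by move=> x; exact: normc_triangle.
- exact: eq_integrable H.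
Qed.

Lemma cintegralD f g : cintegrable mu f -> cintegrable mu g ->
  cintegral mu (fun x => f x + g x) = cintegral mu f + cintegral mu g.
Proof.
move=> [f1 f2] [g1 g2]; apply: complexP => /=.
  by under eq_Rintegral do rewrite raddfD/=; rewrite RintegralD.
by under eq_Rintegral do rewrite raddfD/=; rewrite RintegralD.
Qed.

Lemma cintegrableZl (z : R[i]) f : cintegrable mu f ->
  cintegrable mu (fun x => z * f x).
Proof.
move=> fi; apply: (@cintegrable_dominated _ (fun x => normc z * normc (f x))).
- by apply: cmeasurableM; [exact: cmeasurable_cst|exact: cintegrable_cmeasurable].
- by move=> x; rewrite normcM.
- by apply: integrable_mulr; exact: integrable_normc.
Qed.

Lemma cintegralZl (z : R[i]) f : cintegrable mu f ->
  cintegral mu (fun x => z * f x) = z * cintegral mu f.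
Proof.
move=> [f1 f2].
have Z := @integrable_mulr.
apply: complexP; rewrite ?ReM ?ImM /=.
  under eq_Rintegral do rewrite ReM.
  by rewrite RintegralB// ?RintegralZl//; exact: Z.
under eq_Rintegral do rewrite ImM.
by rewrite RintegralD// ?RintegralZl//; exact: Z.
Qed.

Lemma cintegralB f g : cintegrable mu f -> cintegrable mu g ->
  cintegral mu (fun x => f x - g x) = cintegral mu f - cintegral mu g.
Proof.
move=> fi gi; rewrite -mulN1r -cintegralZl// -cintegralD//; last exact: cintegrableZl.
by congr cintegral; apply/funext => x; rewrite mulN1r.
Qed.

Lemma eq_cintegral f g : f =1 g -> cintegral mu f = cintegral mu g.
Proof. by move=> fg; congr cintegral; exact/funext. Qed.

(** With [z] the integral, the square of its modulus is the integral of [Re z * Re f + Im z * Im f],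
    which Cauchy-Schwarz bounds by [normc z] times the integral of [g]; then divide by [normc z]. *)
Lemma normc_cintegral_le f (g : T -> R) : cmeasurable f ->
  (forall x, normc (f x) <= g x) -> mu.-integrable setT (EFin \o g) ->
  normc (cintegral mu f) <= (\int[mu]_x g x)%R.
Proof.
move=> mf fg ig; have [f1 f2] := cintegrable_dominated mf fg ig.
set z := cintegral mu f.
have [->|z0] := eqVneq (normc z) 0.
  by apply: Rintegral_ge0 => x _; rewrite (le_trans (normc_ge0 _) (fg x)).
have zgt0 : 0 < normc z by rewrite lt_def z0 normc_ge0.
have Z := @integrable_mulr.
rewrite -(ler_pM2l zgt0) -expr2 sqr_normc.
have -> : Re z ^+ 2 + Im z ^+ 2 = Re z * (\int[mu]_x Re (f x))%R
    + Im z * (\int[mu]_x Im (f x))%R by rewrite !expr2.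
rewrite -!RintegralZl// -RintegralD//; [|exact: Z..].
apply: le_Rintegral => //.
- rewrite (_ : _ \o _ = (fun x => (Re z * Re (f x))%:E) \+
     (fun x => (Im z * Im (f x))%:E))%E//.
  by apply: integrableD => //; exact: Z.
- exact: Z.
- move=> x _; apply: le_trans (cauchy_schwarz_complex _ _) _.
  by rewrite ler_wpM2l ?normc_ge0.
Qed.

End one_measure.

Section convergence.

(** Convergence is taken by components, so that the limit theorems for real functions apply to each
    of them. *)
Definition cvgC (u : nat -> R[i]) (z : R[i]) : Prop :=
  ((fun n => Re (u n)) @ \oo --> Re z) /\ ((fun n => Im (u n)) @ \oo --> Im z).

Lemma cvgC_unique u z w : cvgC u z -> cvgC u w -> z = w.
Proof.
move=> [z1 z2] [w1 w2]; apply: complexP.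
  exact: (cvg_unique _ z1 w1).
exact: (cvg_unique _ z2 w2).
Qed.

Lemma cvgCB u z u' z' : cvgC u z -> cvgC u' z' -> cvgC (fun n => u n - u' n) (z - z').
Proof.
by move=> [u1 u2] [v1 v2]; split;
  under eq_fun do rewrite raddfB /=; rewrite raddfB /=; exact: cvgB.
Qed.

Lemma cvgC_normc_le u z (C : R) : cvgC u z -> (forall n, normc (u n) <= C) ->
  normc z <= C.
Proof.
move=> [u1 u2] uC.
have C0 : 0 <= C by exact: le_trans (normc_ge0 _) (uC 0%N).
rewrite -(ler_pXn2r (ltn0Sn 1)) ?nnegrE ?normc_ge0// sqr_normc.
have /cvg_lim <- // : (fun n => Re (u n) ^+ 2 + Im (u n) ^+ 2) @ \oo -->
    Re z ^+ 2 + Im z ^+ 2.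
  by under eq_fun do rewrite !expr2; rewrite !expr2; apply: cvgD; apply: cvgM.
apply: limr_le.
  by apply/cvg_ex; exists (Re z ^+ 2 + Im z ^+ 2);
    under eq_fun do rewrite !expr2; rewrite !expr2; apply: cvgD; apply: cvgM.
apply: nearW => n; rewrite -sqr_normc ler_pXn2r ?nnegrE ?normc_ge0//.
Qed.

Lemma Rdominated_convergence d (T : measurableType d) (mu : {measure set T -> \bar R})
    (f_ : nat -> T -> R) (f g : T -> R) :
  (forall n, measurable_fun setT (f_ n)) ->
  (forall x, f_ ^~ x @ \oo --> f x) ->
  mu.-integrable setT (EFin \o g) ->
  (forall n x, `|f_ n x| <= g x) ->
  mu.-integrable setT (EFin \o f) /\
  (\int[mu]_x f_ n x)%R @[n --> \oo] --> (\int[mu]_x f x)%R.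
Proof.
move=> mf_ f_f ig fg.
have mf : measurable_fun setT f.
  by apply: (measurable_fun_cvg mf_) => x _; exact: f_f.
have [fi _ H] : [/\ mu.-integrable setT (EFin \o f),
    [sequence (\int[mu]_x `|(f_ n x)%:E - (f x)%:E|)%E]_n @ \oo --> 0%E &
    [sequence (\int[mu]_x (f_ n x)%:E)%E]_n @ \oo --> (\int[mu]_x (f x)%:E)%E].
  apply: (@dominated_convergence _ _ _ mu _ _ (fun n x => (f_ n x)%:E) _ (EFin \o g)) => //.
  - by move=> n; exact/measurable_EFinP.
  - exact/measurable_EFinP.
  - by apply: aeW => x _; apply: cvg_EFin; [exact: nearW|exact: f_f].
  - by apply: aeW => x n _ /=; rewrite lee_fin.
split => //; apply: fine_cvg; rewrite fineK//.
exact: integrable_fin_num.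
Qed.

Lemma cdominated_convergence d (T : measurableType d) (mu : {measure set T -> \bar R})
    (f_ : nat -> T -> R[i]) (f : T -> R[i]) (g : T -> R) :
  (forall n, cmeasurable (f_ n)) -> (forall x, cvgC (f_ ^~ x) (f x)) ->
  mu.-integrable setT (EFin \o g) -> (forall n x, normc (f_ n x) <= g x) ->
  cvgC (fun n => cintegral mu (f_ n)) (cintegral mu f).
Proof.
move=> mf cf ig fg; split => /=.
  apply: (Rdominated_convergence (fun n => (mf n).1) (fun x => (cf x).1) ig _).2.
  by move=> n x; rewrite (le_trans (normr_Re_le _)).
apply: (Rdominated_convergence (fun n => (mf n).2) (fun x => (cf x).2) ig _).2.
by move=> n x; rewrite (le_trans (normr_Im_le _)).
Qed.

End convergence.

Section fubini.
Context d1 d2 (T1 : measurableType d1) (T2 : measurableType d2).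
Variable m1 : {sigma_finite_measure set T1 -> \bar R}.
Variable m2 : {sigma_finite_measure set T2 -> \bar R}.

Section real.
Variables (F : T1 -> T2 -> R) (g : T1 -> R) (h : T2 -> R).
Hypothesis mF : measurable_fun setT (fun p : T1 * T2 => F p.1 p.2).
Hypothesis gi : m1.-integrable setT (EFin \o g).
Hypothesis hi : m2.-integrable setT (EFin \o h).
Hypothesis Fgh : forall x y, `|F x y| <= g x * h y.

(** Domination by a product [g x * h y] makes every section integrable, not just almost every one,
    so the real-valued inner integrals are genuine at each point. *)
Lemma integrable_fubini_l x : m2.-integrable setT (EFin \o F x).
Proof.
apply: (@integrable_dominated _ _ _ _ (fun y => g x * h y)) => //.
  exact: (measurableT_comp mF (pair1_measurable x)).
exact: integrable_mulr.
Qed.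

Lemma integrable_fubini_r y : m1.-integrable setT (EFin \o F ^~ y).
Proof.
apply: (@integrable_dominated _ _ _ _ (fun x => h y * g x)) => //.
- exact: (measurableT_comp mF (pair2_measurable y)).
- by move=> x; rewrite mulrC.
- exact: integrable_mulr.
Qed.

Let prod_integrable : (m1 \x m2)%E.-integrable setT (fun p => (F p.1 p.2)%:E).
Proof.
apply/integrable12ltyP => /=; first exact/measurable_EFinP.
(* By Tonelli it suffices to bound the iterated integral of [|F|], here by the product of the [L^1]
   norms of [g] and [h]. *)
apply: (@le_lt_trans _ _ (\int[m1]_x `|(\int[m2]_y `|h y|)%R * g x|%:E)%E).
  apply: ge0_le_integral => //.
  - by move=> x _; exact: integral_ge0.
  - apply: (@measurable_fun_fubini_tonelli_F _ _ _ _ _ m2 (fun p => `|(F p.1 p.2)%:E|%E)) => //.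
    by apply: measurableT_comp => //; exact/measurable_EFinP.
  - apply: measurableT_comp => //; apply: measurableT_comp => //.
    by apply: measurable_funM => //; apply/measurable_EFinP; exact: (measurable_int _ gi).
  - move=> x _; have hn : m2.-integrable setT (EFin \o (fun y => `|h y|)) by exact: integrable_norm.
    have hn' : m2.-integrable setT (EFin \o (fun y => `|g x| * `|h y|)).
      exact: integrable_mulr.
    rewrite normrM ger0_norm; last exact: Rintegral_ge0.
    rewrite mulrC -RintegralZl// /Rintegral fineK; last exact: integrable_fin_num.
    apply: ge0_le_integral => //.
    + by do 2 apply: measurableT_comp => //; exact: (measurableT_comp mF (pair1_measurable x)).
    + exact: (measurable_int _ hn').
    + by move=> y _; rewrite lee_fin (le_trans (Fgh x y))// -normrM ler_norm.
have : m1.-integrable setT (EFin \o (fun x => (\int[m2]_y `|h y|)%R * g x)).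
  exact: integrable_mulr.
by move=> /integrableP[_].
Qed.

Let inner1 x : ((\int[m2]_y F x y)%R%:E = \int[m2]_y (F x y)%:E)%E.
Proof. by rewrite /Rintegral fineK//; exact: integrable_fin_num (integrable_fubini_l x). Qed.

Let inner2 y : ((\int[m1]_x F x y)%R%:E = \int[m1]_x (F x y)%:E)%E.
Proof. by rewrite /Rintegral fineK//; exact: integrable_fin_num (integrable_fubini_r y). Qed.

Lemma integrable_Rfubini_l : m1.-integrable setT (fun x => (\int[m2]_y F x y)%R%:E).
Proof.
under eq_fun do rewrite inner1.
exact: (integrable_fubini_F prod_integrable).
Qed.

Lemma Rfubini : (\int[m1]_x (\int[m2]_y F x y) = \int[m2]_y (\int[m1]_x F x y))%R.
Proof.
rewrite {1}/Rintegral [RHS]/Rintegral; congr fine.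
under eq_integral do rewrite inner1.
rewrite (Fubini prod_integrable).
by apply: eq_integral => y _; rewrite inner2.
Qed.

End real.

Section complex_fubini.
Variables (F : T1 -> T2 -> R[i]) (g : T1 -> R) (h : T2 -> R).
Hypothesis mF : cmeasurable (fun p : T1 * T2 => F p.1 p.2).
Hypothesis gi : m1.-integrable setT (EFin \o g).
Hypothesis hi : m2.-integrable setT (EFin \o h).
Hypothesis Fgh : forall x y, normc (F x y) <= g x * h y.

Let FRe x y : `|Re (F x y)| <= g x * h y.
Proof. exact: le_trans (normr_Re_le _) (Fgh x y). Qed.
Let FIm x y : `|Im (F x y)| <= g x * h y.
Proof. exact: le_trans (normr_Im_le _) (Fgh x y). Qed.

Lemma cintegrable_fubini_l : cintegrable m1 (fun x => cintegral m2 (F x)).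
Proof.
split.
  exact: (integrable_Rfubini_l mF.1 gi hi FRe).
exact: (integrable_Rfubini_l mF.2 gi hi FIm).
Qed.

Lemma cfubini : cintegral m1 (fun x => cintegral m2 (F x)) =
  cintegral m2 (fun y => cintegral m1 (F ^~ y)).
Proof.
apply: complexP => /=.
  exact: (Rfubini mF.1 gi hi FRe).
exact: (Rfubini mF.2 gi hi FIm).
Qed.

End complex_fubini.
End fubini.
End ComplexIntegral.

(** * Laplace transforms and the Poisson kernel *)

Section RealIntegrals.
Context {R : realType}.
Local Notation mu := (@lebesgue_measure R).
Implicit Types (F k : R -> R) (a b d l x y A B : R).

Lemma is_derive_continuous F k : (forall x, is_derive x 1 F (k x)) ->
  continuous F.
Proof.
move=> dF x; apply: differentiable_continuous; apply/derivable1_diffP.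
by have [] := dF x.
Qed.

Lemma integral_halfline_FTC F k l : (forall x, is_derive x 1 F (k x)) ->
  continuous k -> (forall x, 0 <= x -> 0 <= k x) ->
  F x @[x --> +oo] --> l ->
  (\int[mu]_(x in `[0%R, +oo[) (k x)%:E = (l - F 0)%:E)%E.
Proof.
move=> dF ck k0 Fl; rewrite EFinB; apply: ge0_continuous_FTC2y => //.
- exact: continuous_subspaceT.
- by apply: cvg_at_right_filter; exact: is_derive_continuous dF _.
- by move=> x _; rewrite derive1E; have [_ ->] := dF x.
Qed.

(** The line is cut at 0 and the negative half is reflected, where [x |-> - F (- x)] is a primitive
    of [x |-> k (- x)]. *)
Lemma integral_line_FTC F k l (l' : R) : (forall x, is_derive x 1 F (k x)) ->
  continuous k -> (forall x, 0 <= k x) ->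
  F x @[x --> -oo] --> l' -> F x @[x --> +oo] --> l ->
  mu.-integrable setT (EFin \o k) /\ (\int[mu]_x k x)%R = l - l'.
Proof.
move=> dF ck k0 Fl' Fl.
have mk : measurable_fun setT k by exact: continuous_measurable_fun.
have I : (\int[mu]_x (k x)%:E = (l - l')%:E)%E.
  pose D : set R := `[0, +oo[%classic.
  rewrite -(setUv D) ge0_integral_setU; last 5 first.
  - exact: measurable_itv.
  - by apply: measurableC; exact: measurable_itv.
  - by rewrite setUv; exact/measurable_EFinP.
  - by move=> x _; rewrite lee_fin.
  - exact/disj_setPCl.
  rewrite /D setCitvr integral_itv_bndo_bndc; last first.
    by apply/measurable_EFinP; exact: measurable_funTS.
  rewrite (integral_halfline_FTC dF ck _ Fl)//.
  rewrite -{2}oppr0 ge0_integration_by_substitutionNy//; last first.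
    exact: continuous_subspaceT.
  have dF' x : is_derive x 1 (fun x => - F (- x)) ((k \o -%R) x).
    have dFx := dF (- x).
    have H : is_derive x 1 (F \o -%R) (k (- x) * -1) by apply: is_derive1_comp.
    by apply: is_derive_eq; rewrite mulrN1 opprK.
  rewrite (integral_halfline_FTC (l := - l') dF')//.
  - by rewrite -EFinD oppr0 opprK; congr EFin; ring.
  - by move=> x; apply: continuous_comp; [exact: opp_continuous|exact: ck].
  - by move=> x _; exact: k0.
  - by apply: cvgN; have /cvgNy_compNP := Fl'.
split; last by rewrite /Rintegral I.
apply/integrableP; split; first exact/measurable_EFinP.
under eq_integral do rewrite /= ger0_norm//.
by rewrite I ltry.
Qed.

Lemma cvg_expR_decay (d : R) : 0 < d -> expR (- (d * x)) @[x --> +oo] --> (0 : R).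
Proof.
move=> d0; apply: (@cvg_comp _ _ _ (fun x => d * x) (fun x => expR (- x))) (@cvgr_expR R).
exact: gt0_cvgMry.
Qed.

(** Extended by 0 to negative arguments, so that all later integrals run over the whole line and fit
    the Fubini lemmas. *)
Definition exp_halfline (d : R) : R -> R := (fun s => expR (- (d * s))) \_ `[0, +oo[.

Lemma exp_halfline_ge0 d s : 0 <= exp_halfline d s.
Proof. by rewrite /exp_halfline patchE; case: ifP => // _; exact: expR_ge0. Qed.

(* The summand 1 makes the integrand nonnegative, as the fundamental theorem of
   calculus on a half-line requires; it is subtracted again in laplace_trig. *)
Let laplaceE d y A B : 0 < d -> `|A| + `|B| <= 1 ->
  (\int[mu]_(s in `[0%R, +oo[)
     (expR (- (d * s)) * (1 + A * cos (y * s) + B * sin (y * s)))%:E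
  = (d^-1 + (A * d + B * y) / (d ^+ 2 + y ^+ 2))%:E)%E.
Proof.
move=> d0 AB.
have dn0 : d != 0 by rewrite gt_eqF.
have n0 : d ^+ 2 + y ^+ 2 != 0.
  by rewrite gt_eqF// ltr_pwDl ?exprn_gt0 ?sqr_ge0.
(* [G] is the primitive with the exponential factored out, as given by two integrations by parts.
   Being bounded, it leaves a primitive [F] that tends to 0 at infinity. *)
pose G s : R := - d^-1 + (A * (y * sin (y * s) - d * cos (y * s))
  - B * (d * sin (y * s) + y * cos (y * s))) / (d ^+ 2 + y ^+ 2).
pose F s : R := expR (- (d * s)) * G s.
have cosl (s : R) : is_derive s 1 (fun s => cos (y * s)) (- (y * sin (y * s))).
  apply: is_derive_eq.
  by rewrite /GRing.scale/=; ring.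
have sinl (s : R) : is_derive s 1 (fun s => sin (y * s)) (y * cos (y * s)).
  apply: is_derive_eq.
  by rewrite /GRing.scale/=; ring.
have expl (s : R) : is_derive s 1 (fun s => expR (- (d * s))) (- (d * expR (- (d * s)))).
  apply: is_derive_eq.
  by rewrite /GRing.scale/=; ring.
have dF (s : R) : is_derive s 1 F
    (expR (- (d * s)) * (1 + A * cos (y * s) + B * sin (y * s))).
  rewrite /F /G; apply: is_derive_eq.
  by rewrite /GRing.scale/=; field; rewrite dn0 n0.
rewrite (@integral_halfline_FTC F _ 0)//.
- by rewrite /F /G !mulr0 oppr0 expR0 cos0 sin0; congr EFin; field; rewrite dn0 n0.
- move=> s; apply: cvgM; first exact: is_derive_continuous expl _.
  apply: cvgD; last by apply: cvgM; [exact: cvg_cst|exact: is_derive_continuous sinl _].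
  apply: cvgD; first exact: cvg_cst.
  by apply: cvgM; [exact: cvg_cst|exact: is_derive_continuous cosl _].
- move=> s _; rewrite mulr_ge0 ?expR_ge0//.
  have : `|A * cos (y * s)| <= `|A|.
    by rewrite normrM ler_piMr// ler_norml cos_geN1 cos_le1.
  have : `|B * sin (y * s)| <= `|B|.
    by rewrite normrM ler_piMr// ler_norml sin_geN1 sin_le1.
  by rewrite !ler_norml => /andP[? _] /andP[? _]; lra.
- pose M := d^-1 + (`|y| + d + (d + `|y|)) / (d ^+ 2 + y ^+ 2).
  have sin1 s : `|sin (y * s)| <= 1 by rewrite ler_norml sin_geN1 sin_le1.
  have cos1 s : `|cos (y * s)| <= 1 by rewrite ler_norml cos_geN1 cos_le1.
  have A1 : `|A| <= 1 by rewrite (le_trans _ AB)// lerDl.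
  have B1 : `|B| <= 1 by rewrite (le_trans _ AB)// lerDr.
  have lin (p q u v : R) : `|u| <= 1 -> `|v| <= 1 -> `|p * u| + `|q * v| <= `|p| + `|q|.
    by move=> u1 v1; rewrite !normrM lerD// ler_piMr.
  have GM s : `|G s| <= M.
    rewrite /G (le_trans (ler_normD _ _))// normrN normfV (gtr0_norm d0) lerD2l.
    rewrite normrM normfV (@ger0_norm _ (d ^+ 2 + y ^+ 2)) ?addr_ge0 ?sqr_ge0//.
    rewrite ler_wpM2r ?invr_ge0 ?addr_ge0 ?sqr_ge0//.
    rewrite (le_trans (ler_normB _ _))// !normrM lerD//.
      rewrite (le_trans (ler_piMl _ A1))// (le_trans (ler_normB _ _))//.
      by rewrite -[leRHS]/(_ + d) -{2}(gtr0_norm d0) lin.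
    rewrite (le_trans (ler_piMl _ B1))// (le_trans (ler_normD _ _))//.
    by rewrite -{2}(gtr0_norm d0) lin.
  apply: (@squeeze_cvgr _ _ _ _ (fun s => - M * expR (- (d * s)))
    (fun s => M * expR (- (d * s)))).
  + apply: nearW => s; rewrite /F mulNr -ler_norml normrM.
    by rewrite (ger0_norm (expR_ge0 _)) mulrC ler_wpM2r ?expR_ge0.
  + by rewrite -(mulr0 (- M)); apply: cvgM; [exact: cvg_cst|exact: cvg_expR_decay].
  + by rewrite -(mulr0 M); apply: cvgM; [exact: cvg_cst|exact: cvg_expR_decay].
Qed.


Lemma exp_halflineE d s : exp_halfline d s = expR (- (d * s)) * \1_(`[0, +oo[%classic : set R) s.
Proof. by rewrite /exp_halfline patch_indic. Qed.

Lemma measurable_exp_halfline d : measurable_fun setT (exp_halfline d).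
Proof.
rewrite (_ : exp_halfline d = (fun s => expR (- (d * s))) \* \1_`[0, +oo[); last first.
  by rewrite /exp_halfline patch_indic.
apply: measurable_funM; last exact: measurable_indic.
apply: measurableT_comp => //; apply: measurableT_comp => //.
Qed.

Let half_trigE d y A B s :
  exp_halfline d s * (1 + A * cos (y * s) + B * sin (y * s)) =
  ((fun s => expR (- (d * s)) * (1 + A * cos (y * s) + B * sin (y * s))) \_ `[0, +oo[) s.
Proof. by rewrite /exp_halfline !patchE; case: ifP => //; rewrite mul0r. Qed.

Let half_trig_ereal d y A B : 0 < d -> `|A| + `|B| <= 1 ->
  (\int[mu]_s (exp_halfline d s * (1 + A * cos (y * s) + B * sin (y * s)))%:E)%E
  = (d^-1 + (A * d + B * y) / (d ^+ 2 + y ^+ 2))%:E.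
Proof.
move=> d0 AB; rewrite -(@laplaceE d y A B)// [RHS]integral_mkcond.
by apply: eq_integral => s _; rewrite half_trigE restrict_EFin.
Qed.

Let half_trig d y A B : 0 < d -> `|A| + `|B| <= 1 ->
  (\int[mu]_s (exp_halfline d s * (1 + A * cos (y * s) + B * sin (y * s))))%R
  = d^-1 + (A * d + B * y) / (d ^+ 2 + y ^+ 2).
Proof. by move=> d0 AB; rewrite /Rintegral half_trig_ereal. Qed.

Let half_exp_ereal d : 0 < d -> (\int[mu]_s (exp_halfline d s)%:E)%E = d^-1%:E.
Proof.
move=> d0; have AB : `|0 : R| + `|0 : R| <= 1 by rewrite normr0 addr0.
transitivity ((d^-1 + (0 * d + 0 * 0) / (d ^+ 2 + 0 ^+ 2))%:E : \bar R); last first.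
  by rewrite !mul0r addr0 mul0r addr0.
rewrite -(@half_trig_ereal d 0 _ _ d0 AB).
by apply: eq_integral => s _; rewrite !mul0r !addr0 mulr1.
Qed.

Let half_exp d : 0 < d -> (\int[mu]_s exp_halfline d s)%R = d^-1.
Proof. by move=> d0; rewrite /Rintegral half_exp_ereal. Qed.

Lemma integrable_exp_halfline d : 0 < d ->
  mu.-integrable setT (EFin \o exp_halfline d).
Proof.
move=> d0; apply/integrableP; split.
  by apply/measurable_EFinP; exact: measurable_exp_halfline.
under eq_integral do rewrite /= ger0_norm ?exp_halfline_ge0//.
by rewrite half_exp_ereal ?ltry.
Qed.

Lemma cmp_trig_le1 y A B s : `|A| + `|B| <= 1 ->
  `|A * cos (y * s) + B * sin (y * s)| <= 1.
Proof.
move=> AB; rewrite (le_trans (ler_normD _ _))// (le_trans _ AB)// !normrM lerD//.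
  by rewrite ler_piMr// ler_norml cos_geN1 cos_le1.
by rewrite ler_piMr// ler_norml sin_geN1 sin_le1.
Qed.

Lemma measurable_cosM y : measurable_fun setT (fun s : R => cos (y * s)).
Proof.
apply: (@measurableT_comp _ _ _ _ _ _ (@cos R)); last exact: measurable_funM.
by apply: continuous_measurable_fun; exact: continuous_cos.
Qed.

Lemma measurable_sinM y : measurable_fun setT (fun s : R => sin (y * s)).
Proof.
apply: (@measurableT_comp _ _ _ _ _ _ (@sin R)); last exact: measurable_funM.
by apply: continuous_measurable_fun; exact: continuous_sin.
Qed.

Lemma laplace_trig d y A B : 0 < d -> `|A| + `|B| <= 1 ->
  (\int[mu]_s (exp_halfline d s * (A * cos (y * s) + B * sin (y * s))))%R
  = (A * d + B * y) / (d ^+ 2 + y ^+ 2).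
Proof.
move=> d0 AB; have := half_trig y d0 AB; rewrite -(half_exp d0).
have i1 := integrable_exp_halfline d0.
have i2 : mu.-integrable setT (EFin \o (fun s =>
    exp_halfline d s * (A * cos (y * s) + B * sin (y * s)))).
  apply: (integrable_dominated _ _ i1).
    apply: measurable_funM; first exact: measurable_exp_halfline.
    apply: measurable_funD; apply: measurable_funM => //.
      exact: measurable_cosM.
    exact: measurable_sinM.
  move=> s; rewrite normrM (ger0_norm (exp_halfline_ge0 _ _)) ler_piMr ?exp_halfline_ge0//.
  exact: cmp_trig_le1.
rewrite (_ : (\int[mu]_s _)%R = (\int[mu]_s (exp_halfline d s +
  exp_halfline d s * (A * cos (y * s) + B * sin (y * s))))%R); last first.
  by apply: eq_Rintegral => s _; ring.
by rewrite RintegralD// => /eqP; rewrite (inj_eq (addrI _)) => /eqP.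
Qed.

Lemma cvgy_affine_div a d : 0 < d -> (x - a) / d @[x --> +oo] --> +oo.
Proof.
move=> d0; apply/cvgryPge => M; near=> x; rewrite ler_pdivlMr// lerBrDr.
by near: x; apply: nbhs_pinfty_ge; exact: num_real.
Unshelve. all: by end_near. Qed.

(** The integrand is the derivative of [atan ((x - a) / d) / pi], which increases from [- 1 / 2] to
    [1 / 2]. *)
Lemma poisson_kernel a d : 0 < d ->
  mu.-integrable setT (EFin \o (fun x => d / (pi * (d ^+ 2 + (a - x) ^+ 2)))) /\
  (\int[mu]_x (d / (pi * (d ^+ 2 + (a - x) ^+ 2))))%R = 1.
Proof.
move=> d0.
have dn0 : d != 0 by rewrite gt_eqF.
have pn0 : (pi : R) != 0 by rewrite gt_eqF// pi_gt0.
have n0 x : d ^+ 2 + (a - x) ^+ 2 != 0.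
  by rewrite gt_eqF// ltr_pwDl ?exprn_gt0 ?sqr_ge0.
have dF (x : R) : is_derive x 1 (fun x => atan ((x - a) / d) / pi)
    (d / (pi * (d ^+ 2 + (a - x) ^+ 2))).
  apply: is_derive_eq; rewrite /GRing.scale/=.
  have n1 := n0 x; move: pn0; generalize (pi : R) => p pn0; field.
  by rewrite n1 pn0 dn0.
have cvgF (b : R) : atan ((x - b) / d) / pi @[x --> +oo] --> (2^-1 : R).
  have -> : 2^-1 = pi / 2 / pi :> R by rewrite mulrAC divff// mul1r.
  apply: cvgM; last exact: cvg_cst.
  exact: (cvg_comp _ _ (cvgy_affine_div b d0) (@cvgy_atan R)).
have -> : 1 = 2^-1 - (- 2^-1) :> R by field.
apply: (integral_line_FTC dF) (cvgF a).
- move=> x; apply: cvgM; first exact: cvg_cst.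
  apply: cvgV; first by rewrite mulf_neq0.
  apply: cvgM; first exact: cvg_cst.
  apply: cvgD; first exact: cvg_cst.
  by apply: (@cvgM _ _ _ _ (fun x => a - x) (fun x => a - x));
    apply: cvgB; [exact: cvg_cst|exact: cvg_id|exact: cvg_cst|exact: cvg_id].
- by move=> x; rewrite divr_ge0 ?(ltW d0)// mulr_ge0 ?pi_ge0// addr_ge0 ?sqr_ge0.
- apply/cvgNy_compNP.
  rewrite (_ : _ \o _ = (fun x => - (atan ((x - - a) / d) / pi))); last first.
    by apply/funext => x /=; rewrite -mulNr -atanN; congr (atan _ / _); ring.
  by apply: cvgN; exact: cvgF.
Qed.

End RealIntegrals.

(** * The atan sine transform and approximate identities *)

Section AtanTransform.
Context {R : realType}.
Local Notation mu := (@lebesgue_measure R).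
Implicit Types (F k g : R -> R) (a b d l x y z xi : R).

Lemma integral_itv_FTC F k a b : a < b ->
  (forall x, a <= x <= b -> is_derive x 1 F (k x)) ->
  (forall x, a <= x <= b -> {for x, continuous k}) ->
  (\int[mu]_(x in `[a, b]) (k x)%:E = (F b - F a)%:E)%E.
Proof.
move=> ab dF ck.
have cF x : a <= x <= b -> {for x, continuous F}.
  move=> /dF [? _]; apply: differentiable_continuous; exact/derivable1_diffP.
rewrite EFinB; apply: continuous_FTC2 => //.
- apply: continuous_in_subspaceT => x; rewrite inE/= in_itv/=; exact: ck.
- split.
  + by move=> x; rewrite in_itv/= => /andP[/ltW ax /ltW xb]; have [|//] := dF x; rewrite ax.
  + by apply: cvg_at_right_filter; apply: cF; rewrite lexx ltW.
  + by apply: cvg_at_left_filter; apply: cF; rewrite lexx ltW.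
- move=> x; rewrite in_itv/= => /andP[/ltW ax /ltW xb]; rewrite derive1E.
  by have [|_ ->//] := dF x; rewrite ax.
Qed.

(* On xi > 0 this is the integral of exp(- s * xi) over s in [a, b]. *)
Definition sine_weight a b xi : R := (exp_halfline a xi - exp_halfline b xi) / xi.

(** Factor out [exp (- a xi)] and use [1 - exp (- u) <= u] with [u = (b - a) xi]: the division by
    [xi] creates no singularity. At [xi = 0] the convention [0^-1 = 0] makes the weight vanish. *)
Lemma sine_weight_bounds a b xi : 0 < a -> a < b ->
  0 <= sine_weight a b xi <= (b - a) * exp_halfline a xi.
Proof.
move=> a0 ab; rewrite /sine_weight /exp_halfline !patchE.
case: ifPn => [|_]; last by rewrite subrr mul0r mulr0 lexx.
rewrite inE/= in_itv/= andbT le_eqVlt => /predU1P[<-|xi0].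
  by rewrite invr0 mulr0 lexx mulr_ge0 ?subr_ge0 ?expR_ge0 ?ltW.
rewrite divr_ge0 ?(ltW xi0)//= ?subr_ge0 ?ler_expR ?lerN2 ?ler_pM2r ?(ltW ab)//.
rewrite ler_pdivrMr//.
have -> : expR (- (b * xi)) = expR (- (a * xi)) * expR (- ((b - a) * xi)).
  by rewrite -expRD; congr expR; ring.
have := expR_ge1Dx (- ((b - a) * xi)).
have := expR_ge0 (- (a * xi)).
set e := expR (- (a * xi)); set f := expR (- ((b - a) * xi)) => e0 f1.
have : e * (1 - (b - a) * xi) <= e * f by rewrite ler_wpM2l.
by lra.
Qed.

(** This bound is uniform in [a] and [b], so it persists when [a] tends to 0 and [b] to infinity; it
    turns [xi ^ v] into [xi ^ (v - 1)] in part (b). *)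
Lemma sine_weight_le_inv a b xi : 0 < a -> a < b -> 0 < xi ->
  sine_weight a b xi <= xi^-1.
Proof.
move=> a0 ab xi0; rewrite /sine_weight -[leRHS]mul1r ler_wpM2r ?invr_ge0 ?(ltW xi0)//.
rewrite (@le_trans _ _ (exp_halfline a xi))// ?gerBl ?exp_halfline_ge0//.
rewrite /exp_halfline patchE mem_set/= ?in_itv/= ?(ltW xi0)//.
by rewrite -expR0 ler_expR oppr_le0 mulr_ge0// ltW.
Qed.

Lemma sine_weight_lt0 a b xi : xi < 0 -> sine_weight a b xi = 0.
Proof.
move=> xi0; rewrite /sine_weight /exp_halfline !patchE memNset ?subrr ?mul0r//.
by rewrite /= in_itv/= andbT leNgt xi0.
Qed.

(** Writing [x^-1] as [x * (x ^ 2)^-1] leaves only a real power of a nonnegative number, which is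
    measurable; at 0 both sides are 0. *)
Lemma measurable_invr : measurable_fun setT (fun x : R => x^-1).
Proof.
rewrite (_ : (fun x => x^-1) = (fun x : R => x * (x ^+ 2) `^ (-1))).
  apply: measurable_funM => //.
  by apply: (@measurableT_comp _ _ _ _ _ _ (@powR R ^~ (-1))).
apply/funext => x; rewrite powR_inv1 ?sqr_ge0//.
by have [->|x0] := eqVneq x 0; [rewrite mul0r invr0|rewrite expr2 invfM mulrA divff ?mul1r].
Qed.

Lemma measurable_sine_weight a b : measurable_fun setT (sine_weight a b).
Proof.
apply: measurable_funM; last exact: measurable_invr.
by apply: measurable_funB; exact: measurable_exp_halfline.
Qed.

Lemma integrable_sine_weight a b : 0 < a -> a < b ->
  mu.-integrable setT (EFin \o sine_weight a b).
Proof.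
move=> a0 ab; have H := integrable_mulr (b - a) (integrable_exp_halfline a0).
apply: (integrable_dominated _ _ H); first exact: measurable_sine_weight.
by move=> xi; have /andP[? ?] := sine_weight_bounds xi a0 ab; rewrite ger0_norm.
Qed.

Lemma integral_inv_sqrD a b z : 0 < a -> a < b ->
  (\int[mu]_(s in `[a, b]) (z / (s ^+ 2 + z ^+ 2)))%R = atan (b / z) - atan (a / z).
Proof.
(* For [z = 0] both quotients [b / z] and [a / z] are 0 by convention, and so is the integrand. *)
move=> a0 ab; have [->|z0] := eqVneq z 0.
  rewrite invr0 !mulr0 subrr; under eq_Rintegral do rewrite mul0r.
  by rewrite Rintegral_cst// mul0r.
have n0 s : s ^+ 2 + z ^+ 2 != 0.
  by rewrite gt_eqF// ltr_wpDl ?sqr_ge0// exprn_even_gt0.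
have dF (s : R) : a <= s <= b ->
    is_derive s 1 (fun s => atan (s / z)) (z / (s ^+ 2 + z ^+ 2)).
  move=> _; apply: is_derive_eq; rewrite /GRing.scale/=; field.
  by rewrite z0 n0.
rewrite /Rintegral (integral_itv_FTC ab dF)// => s _.
apply: cvgM; first exact: cvg_cst.
apply: cvgV => //; apply: cvgD; last exact: cvg_cst.
exact: exprn_continuous.
Qed.

(** Replace the weight by the integral of [exp (- s xi)] over [s] in [[a, b]] and exchange the
    integrals: the Laplace transform of the sine is [z / (s ^ 2 + z ^ 2)], whose integral over [s]
    is the difference of arctangents. *)
Lemma sine_transform_atan a b z : 0 < a -> a < b ->
  (\int[mu]_xi (sine_weight a b xi * sin (z * xi)))%R = atan (b / z) - atan (a / z).
Proof.
move=> a0 ab.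
(* The indicator of [[a, b]] puts the [s] integral on the whole line, and [s >= a] there gives the
   product bound [I s * exp_halfline a xi] that Fubini requires. *)
pose I : R -> R := \1_(`[a, b]%classic : set R).
have mI : measurable_fun setT I by exact: measurable_indic.
pose F s xi := I s * exp_halfline s xi * sin (z * xi).
have I0 s : 0 <= I s by rewrite /I indicE.
have Fdom s xi : `|F s xi| <= I s * exp_halfline a xi.
  rewrite /F normrM (@ger0_norm _ (I s * _)) ?mulr_ge0 ?exp_halfline_ge0//.
  rewrite (@le_trans _ _ (I s * exp_halfline s xi))//.
    by rewrite ler_piMr ?mulr_ge0 ?exp_halfline_ge0// ler_norml sin_geN1 sin_le1.
  rewrite /I indicE; case: (boolP (s \in _)); rewrite ?mul0r// !mul1r inE/= in_itv/=.
  move=> /andP[as_ _]; rewrite /exp_halfline !patchE; case: ifPn => //.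
  by rewrite inE/= in_itv/= andbT => xi0; rewrite ler_expR lerN2 ler_wpM2r.
have mF : measurable_fun setT (fun p : R * R => F p.1 p.2).
  rewrite /F; apply: measurable_funM.
    apply: measurable_funM; first exact: measurableT_comp.
    under eq_fun do rewrite exp_halflineE.
    apply: measurable_funM; last by apply: measurableT_comp => //; exact: measurable_indic.
    apply: measurableT_comp => //; apply: measurableT_comp => //.
    exact: measurable_funM.
  apply: (@measurableT_comp _ _ _ _ _ _ (fun x => sin (z * x))) => //.
  exact: measurable_sinM.
have Ii : mu.-integrable setT (EFin \o I) by exact: integrable_indic_itv.
have Ei := integrable_exp_halfline a0.
have := @Rfubini R _ _ _ _ mu mu F I (exp_halfline a) mF Ii Ei Fdom.
rewrite (_ : (\int[mu]_x (\int[mu]_y F x y))%R = atan (b / z) - atan (a / z)).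
  move=> ->; congr (fine (integral _ _ _)); apply/funext => xi; congr EFin.
  rewrite (_ : (fun s => F s xi) = (fun s => exp_halfline s xi * sin (z * xi)) \_ `[a, b]);
    last by apply/funext => s; rewrite /F patch_indic /= -mulrA mulrC.
  rewrite -Rintegral_mkcond.
  have [xi0|xi0] := leP xi 0.
    have E0 s : exp_halfline s xi * sin (z * xi) = 0.
      move: xi0; rewrite le_eqVlt => /predU1P[->|xi0]; first by rewrite mulr0 sin0 mulr0.
      by rewrite /exp_halfline patchE memNset ?mul0r//= in_itv/= andbT leNgt xi0.
    under eq_Rintegral do rewrite E0.
    by rewrite Rintegral_cst// mul0r /sine_weight mulrAC mulrBl !E0 subrr mul0r.
  have eE s : exp_halfline s xi = expR (- (s * xi)).
    by rewrite /exp_halfline patchE mem_set//= in_itv/= (ltW xi0).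
  have dG (s : R) : a <= s <= b -> is_derive s 1
      (fun s => - (expR (- (s * xi)) / xi * sin (z * xi))) (expR (- (s * xi)) * sin (z * xi)).
    move=> _; apply: is_derive_eq; rewrite /GRing.scale/=; field.
    by rewrite gt_eqF.
  under eq_Rintegral do rewrite eE.
  rewrite /Rintegral (integral_itv_FTC ab dG)/= /sine_weight ?eE; first ring.
  move=> s _; apply: cvgM; last exact: cvg_cst.
  apply: continuous_cvg; first exact: continuous_expR.
  by apply: cvgN; apply: cvgM; [exact: cvg_id|exact: cvg_cst].
rewrite -integral_inv_sqrD// [RHS]Rintegral_mkcond.
congr (fine (integral _ _ _)); apply/funext => s; congr EFin.
rewrite patch_indic /= -/I mulrC.
under eq_Rintegral do rewrite /F -mulrA.
have [sab|sab] := boolP (s \in (`[a, b]%classic : set R)); last first.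
  rewrite /I indicE (negbTE sab) mul0r.
  by under eq_Rintegral do rewrite mul0r; rewrite Rintegral_cst// mul0r.
rewrite /I indicE sab mul1r; under eq_Rintegral do rewrite mul1r.
have s0 : 0 < s.
  by move: sab; rewrite inE/= in_itv/= => /andP[+ _]; exact: lt_le_trans.
have := @laplace_trig R s z 0 1 s0; rewrite normr0 add0r normr1 lexx => /(_ isT).
rewrite mul0r add0r mul1r => <-.
by apply: eq_Rintegral => xi _; rewrite mul0r add0r mul1r.
Qed.

End AtanTransform.

Section ApproximateIdentity.
Context {R : realType}.
Local Notation mu := (@lebesgue_measure R).

(** The function is [pi] times the Poisson kernel of width 1. *)
Lemma integrable_inv1Dsqr (a : R) :
  mu.-integrable setT (EFin \o (fun x => (1 + (a - x) ^+ 2)^-1)).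
Proof.
have [H _] := @poisson_kernel R a 1 ltr01.
have := integrable_mulr pi H; apply: eq_integrable => // x _ /=.
by rewrite expr1n mul1r invfM mulrA divff ?mul1r// gt_eqF// pi_gt0.
Qed.

(** The quadratic tail bound replaces concentration of the kernels: away from [a] it compares [k n]
    with [tau n / (1 + (a - x) ^ 2)], so [g] only has to be integrable against this weight. Both the
    integrable test functions and the bounded primitives satisfy that, with Poisson and logistic
    kernels respectively. *)
Lemma approximate_identity (k : nat -> R -> R) (tau : nat -> R) (g : R -> R) (a : R) :
  (forall n x, 0 <= k n x) -> (forall n, mu.-integrable setT (EFin \o k n)) ->
  (forall n, (\int[mu]_x k n x)%R = 1) ->
  (forall n x, k n x * (a - x) ^+ 2 <= tau n) -> tau n @[n --> \oo] --> 0 ->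
  measurable_fun setT g -> {for a, continuous g} ->
  mu.-integrable setT (EFin \o (fun x => g x / (1 + (a - x) ^+ 2))) ->
  (\int[mu]_x (g x * k n x))%R @[n --> \oo] --> g a.
Proof.
move=> k0 ki k1 ktau tau0 mg cg gi.
have Di x : 0 < 1 + (a - x) ^+ 2 by rewrite ltr_pwDl ?sqr_ge0.
pose W x := `|g x - g a| / (1 + (a - x) ^+ 2).
have W0 x : 0 <= W x by rewrite divr_ge0// ltW.
have Wi : mu.-integrable setT (EFin \o W).
  have H := integrable_mulr (g a) (integrable_inv1Dsqr a).
  have := integrable_norm (integrableB measurableT gi H).
  apply: eq_integrable => // x _ /=.
  by rewrite /W -mulrBl normrM [`|_^-1|]ger0_norm// invr_ge0 ltW.
pose C := (\int[mu]_x W x)%R.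
have C0 : 0 <= C by apply: Rintegral_ge0.
have tau_ge0 n : 0 <= tau n.
  by rewrite (le_trans _ (ktau n a))// mulr_ge0// sqr_ge0.
apply/cvgrPdist_le => e e0.
have e2 : 0 < e / 2 by rewrite divr_gt0.
have /cvgrPdist_le /(_ _ e2) [eta /= eta0 Heta] := cg.
(* Chosen so that [1 + u <= D * u] as soon as [u >= eta ^ 2]; it is applied to [u = (a - x) ^ 2]. *)
pose D := 1 + eta ^- 2.
have D0 : 0 <= D by rewrite addr_ge0// invr_ge0 exprn_ge0// ltW.
have key n x : `|(g x - g a) * k n x| <= e / 2 * k n x + tau n * D * W x.
  rewrite normrM (ger0_norm (k0 n x)).
  have [xa|xa] := ltP `|a - x| eta.
    rewrite -[leLHS]addr0 lerD//; last by apply: mulr_ge0 => //; exact: mulr_ge0.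
    by rewrite ler_wpM2r// distrC; apply: Heta.
  rewrite -[leLHS]add0r lerD//; first by rewrite mulr_ge0// ltW.
  rewrite /W mulrCA ler_wpM2l// ler_pdivlMr//.
  have xa2 : eta ^+ 2 <= (a - x) ^+ 2.
    by rewrite -(real_normK (num_real (a - x))) lerXn2r// ?nnegrE// ltW.
  have xa0 : 0 < (a - x) ^+ 2 by rewrite (lt_le_trans _ xa2)// exprn_gt0.
  rewrite (@le_trans _ _ (k n x * (a - x) ^+ 2 * D))//; last by rewrite ler_wpM2r.
  rewrite -mulrA ler_wpM2l// /D mulrDr mulr1 addrC lerD2l.
  by rewrite ler_pdivlMr ?mul1r// exprn_gt0.
have Hi n : mu.-integrable setT (EFin \o (fun x => e / 2 * k n x + tau n * D * W x)).
  have := integrableD measurableT (integrable_mulr (e / 2) (ki n))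
    (integrable_mulr (tau n * D) Wi).
  exact: eq_integrable.
have gki n : mu.-integrable setT (EFin \o (fun x => (g x - g a) * k n x)).
  apply: (integrable_dominated _ _ (Hi n)) => [|x]; last exact: key.
  apply: measurable_funM; first by apply: measurable_funB.
  by apply/measurable_EFinP; exact: measurable_int (ki n).
have E n : g a - (\int[mu]_x (g x * k n x))%R = - (\int[mu]_x ((g x - g a) * k n x))%R.
  rewrite -[X in X - _]mulr1 -(k1 n) -RintegralZl//.
  rewrite (_ : (\int[mu]_x (g x * k n x))%R =
    (\int[mu]_x (g a * k n x + (g x - g a) * k n x))%R); last first.
    by apply: eq_Rintegral => x _; ring.
  rewrite RintegralD//; last exact: integrable_mulr.
  by rewrite opprD addrA subrr sub0r.
have : \forall n \near \oo, tau n * (D * C) <= e / 2.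
  have : tau n * (D * C) @[n --> \oo] --> 0 * (D * C) by apply: cvgM => //; exact: cvg_cst.
  rewrite mul0r => /cvgrPdist_le /(_ _ e2); apply: filterS => n.
  by rewrite sub0r normrN => /ler_normlW.
apply: filterS => n taun.
rewrite E normrN (le_trans (le_normr_Rintegral _ (gki n)))//.
rewrite (@le_trans _ _ (\int[mu]_x (e / 2 * k n x + tau n * D * W x))%R)//.
  apply: le_Rintegral => //; exact: integrable_norm.
rewrite RintegralD//; [|exact: integrable_mulr..].
rewrite !RintegralZl// k1 mulr1 -mulrA -/C [leRHS](splitr e) lerD2l//.
Qed.

End ApproximateIdentity.

(** * Gamma integrals *)

Section GammaIntegral.
Context {R : realType}.
Local Notation mu := (@lebesgue_measure R).
Implicit Types (a b c s x alpha : R) (h k : R -> R).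

Lemma is_derive_continuous_at h x l : is_derive x 1 h l -> {for x, continuous h}.
Proof. by move=> [? _]; apply: differentiable_continuous; exact/derivable1_diffP. Qed.

Lemma continuous_ln_gt0 x : 0 < x -> {for x, continuous (@ln R)}.
Proof. by move=> /is_derive1_ln; exact: is_derive_continuous_at. Qed.

Lemma ge0_integral_halfline_le h (C : R) :
  measurable_fun setT h -> (forall x, 0 <= h x) ->
  (forall a b, 0 < a -> a < b -> (\int[mu]_(x in `[a, b]) (h x)%:E <= C%:E)%E) ->
  (\int[mu]_(x in `]0%R, +oo[) (h x)%:E <= C%:E)%E.
Proof.
move=> mh h0 hC.
(* The shift by 2 makes the left endpoint smaller than the right one already for [n = 0]. *)
pose I (n : nat) : set R := `[n.+2%:R^-1, n.+2%:R]%classic.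
have UI : `]0%R, +oo[%classic = \bigcup_n I n.
  apply/seteqP; split => [x|x [n _]]/=.
    rewrite in_itv/= andbT => x0.
    exists (Num.truncn (x + x^-1)) => //.
    set n := Num.truncn _.
    have xn : x + x^-1 <= n.+2%:R.
      by apply: le_trans (ltW (truncnS_gt _)) _; rewrite ler_nat.
    have xV0 : 0 < x^-1 by rewrite invr_gt0.
    rewrite /I/= in_itv/=; apply/andP; split; last by lra.
    by rewrite invf_ple ?posrE//; lra.
  by rewrite /I/= !in_itv/= andbT => /andP[+ _]; apply: lt_le_trans.
have ndI : {homo I : n m / (n <= m)%N >-> (n <= m)%O}.
  move=> n m nm; rewrite subsetEset /I => x /=; rewrite !in_itv/= => /andP[nx xn].
  rewrite (le_trans _ nx) ?(le_trans xn) ?ler_nat//.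
  by rewrite lef_pV2 ?posrE// ler_nat.
have H : (\int[mu]_(x in I n) (h x)%:E)%E @[n --> \oo] -->
    (\int[mu]_(x in \bigcup_n I n) (h x)%:E)%E.
  apply: ge0_nondecreasing_set_cvg_integral => //.
  - by move=> n; exact: measurable_itv.
  - by move=> n; apply: measurable_funTS; exact/measurable_EFinP.
  - by move=> n x _; rewrite lee_fin.
rewrite UI -(cvg_lim _ H)//; apply: lime_le; first by apply/cvg_ex; eexists; exact: H.
apply: nearW => n; apply: hC; first by rewrite invr_gt0.
by rewrite (@lt_trans _ _ 1)// ?invf_lt1 ?ltr1n// ltr1n.
Qed.

Definition gamma_fun s x : R := x `^ (s - 1) * expR (- x).

Lemma gamma_fun_ge0 s x : 0 <= gamma_fun s x.
Proof. by rewrite mulr_ge0 ?powR_ge0 ?expR_ge0. Qed.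

Lemma measurable_gamma_fun s : measurable_fun setT (gamma_fun s).
Proof. by apply: measurable_funM => //; apply: measurableT_comp. Qed.

Lemma gamma_funE s x : 0 < x -> gamma_fun s x = expR ((s - 1) * ln x - x).
Proof. by move=> x0; rewrite /gamma_fun /powR gt_eqF// expRD. Qed.

(* The integrand is dominated by a multiple of the derivative of (x / (1 + x))^s. *)
Lemma gamma_fun_itv_le s a b : 0 < s -> 0 < a -> a < b ->
  (\int[mu]_(x in `[a, b]) (gamma_fun s x)%:E
    <= (expR (1 + (s + 1) * ln (s + 1)) / s)%:E)%E.
Proof.
move=> s0 a0 ab; set C := expR _.
pose k x := C * expR ((s - 1) * ln x - (s + 1) * ln (1 + x)).
pose F x := C / s * expR (s * (ln x - ln (1 + x))).
have gt0 x : a <= x <= b -> 0 < x by move=> /andP[+ _]; exact: lt_le_trans.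
have dF x : a <= x <= b -> is_derive x 1 F (k x).
  move=> /gt0 x0; have x1 : 0 < 1 + x by rewrite addr_gt0.
  have d1 := is_derive1_ln x0; have d2 := is_derive1_ln x1.
  have d3 : is_derive x 1 (fun x => ln (1 + x)) (1 + x)^-1.
    have := @is_derive1_comp R (@ln R) (fun x => 1 + x) x _ _ d2 _.
    move=> /(_ 1); rewrite mulr1; apply; apply: is_derive_eq.
    by rewrite add0r mulr1.
  apply: is_derive_eq.
  have -> : k x = C / s * (expR (s * (ln x - ln (1 + x))) * (s * (x^-1 - (1 + x)^-1))).
    have -> : x^-1 - (1 + x)^-1 = expR (- ln x) * expR (- ln (1 + x)).
      by rewrite !expRN !lnK ?posrE//; field; rewrite !gt_eqF.
    have e1 : expR ((s - 1) * ln x - (s + 1) * ln (1 + x)) =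
        expR (s * (ln x - ln (1 + x))) * (expR (- ln x) * expR (- ln (1 + x))).
      by rewrite -!expRD; congr expR; ring.
    by rewrite /k e1; field; rewrite gt_eqF.
  rewrite /GRing.scale/=; ring.
have kge x : a <= x <= b -> gamma_fun s x <= k x.
  move=> /gt0 x0; rewrite gamma_funE// /k /C -expRD ler_expR.
  have s1 : 0 < s + 1 by rewrite addr_gt0.
  have x1 : 0 < 1 + x by rewrite addr_gt0.
  (* The tangent bound [ln u <= u - 1] at [u = (1 + x) / (s + 1)] is the origin of [C]: it keeps
     [(s + 1) * ln (1 + x) - x] below the exponent of [C]. *)
  have : ln ((1 + x) / (s + 1)) <= (1 + x) / (s + 1) - 1.
    rewrite -[X in ln X](addrNK 1) addrC; apply: le_ln1Dx.
    by rewrite ltrBrDl subrr divr_gt0.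
  rewrite ln_div ?posrE// -(ler_pM2l s1) mulrBr [leRHS]mulrBr mulr1 mulrCA divff ?gt_eqF// mulr1.
  by lra.
have cF : (\int[mu]_(x in `[a, b]) (k x)%:E = (F b - F a)%:E)%E.
  apply: integral_itv_FTC => // x /gt0 x0.
  apply: cvgM; first exact: cvg_cst.
  apply: continuous_cvg; first exact: continuous_expR.
  apply: cvgB; apply: cvgM; [exact: cvg_cst|exact: continuous_ln_gt0|exact: cvg_cst|].
  apply: continuous_cvg; first by apply: continuous_ln_gt0; rewrite addr_gt0.
  by apply: cvgD; [exact: cvg_cst|exact: cvg_id].
rewrite (@le_trans _ _ (\int[mu]_(x in `[a, b]) (k x)%:E)%E)//.
  apply: ge0_le_integral => //.
  - by move=> x _; rewrite lee_fin gamma_fun_ge0.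
  - by apply/measurable_EFinP; apply: measurable_funTS; exact: measurable_gamma_fun.
  - apply/measurable_EFinP; apply: measurable_funTS.
    apply: measurable_funM => //; apply: measurableT_comp => //.
    apply: measurable_funB; apply: measurable_funM => //.
    by apply: measurableT_comp => //; exact: measurable_funD.
rewrite cF lee_fin; have Cs : 0 <= C / s by rewrite divr_ge0 ?expR_ge0 ?ltW.
rewrite (@le_trans _ _ (F b))//; first by rewrite gerBl mulr_ge0 ?expR_ge0.
rewrite /F ler_piMr// -expR0 ler_expR mulr_ge0_le0 ?(ltW s0)// subr_le0.
have b0 : 0 < b by exact: lt_trans ab.
by rewrite ler_ln ?posrE ?addr_gt0// lerDr.
Qed.

(** [Gamma] is defined through [fine], which sends infinity to 0; the uniform bound on compact
    intervals shows that the integral is finite, so [Gamma s] is its true value. *)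
Lemma Gamma_integral s : 0 < s ->
  (\int[mu]_(x in `]0%R, +oo[) (gamma_fun s x)%:E = (Gamma s)%:E)%E.
Proof.
move=> s0; rewrite /Gamma /Rintegral fineK// ge0_fin_numE; last first.
  by apply: integral_ge0 => x _; rewrite lee_fin gamma_fun_ge0.
have := ge0_integral_halfline_le (measurable_gamma_fun s) (gamma_fun_ge0 s)
  (fun a b => @gamma_fun_itv_le s a b s0).
by move=> /le_lt_trans; apply; exact: ltry.
Qed.

(** Substitute [u = (c x) ^ alpha / 2] on each compact subinterval; the Jacobian yields the constant
    [D] times the Gamma integrand, and enlarging [[F a, F b]] to the half-line only increases the
    integral. *)
Lemma stretched_exp_integral_le c alpha s : 0 < c -> 0 < alpha -> 0 < s ->
  (\int[mu]_(x in `]0%R, +oo[) (x `^ (s - 1) * expR (- ((c * x) `^ alpha / 2)))%:E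
    <= (2 `^ (s / alpha) * Gamma (s / alpha) / (alpha * c `^ s))%:E)%E.
Proof.
move=> c0 al0 s0; apply: ge0_integral_halfline_le.
- apply: measurable_funM => //; apply: measurableT_comp => //; apply: measurableT_comp => //.
  apply: measurable_funM => //.
  by apply: (@measurableT_comp _ _ _ _ _ _ (@powR R ^~ alpha)) => //.
- by move=> x; rewrite mulr_ge0 ?powR_ge0 ?expR_ge0.
move=> a b a0 ab.
(* For [x > 0] this is [(c x) ^ alpha / 2], written with [expR] and [ln] so that its derivative
   follows from the basic rules. *)
pose F x : R := expR (alpha * (ln c + ln x)) / 2.
pose k x : R := alpha * x^-1 * F x.
have F0 x : 0 < F x by rewrite divr_gt0 ?expR_gt0.
have dF x : 0 < x -> is_derive x 1 F (k x).
  move=> x0; have d1 := is_derive1_ln x0.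
  by apply: is_derive_eq; rewrite /k /F /GRing.scale/=; ring.
have ck x : 0 < x -> {for x, continuous k}.
  move=> x0; apply: cvgM; last exact: (is_derive_continuous_at (dF _ x0)).
  by apply: cvgM; [exact: cvg_cst|apply: cvgV; [rewrite gt_eqF|exact: cvg_id]].
have nk x : 0 < x -> \forall y \near x, k y = derive1 F y.
  move=> x0; near=> y; rewrite derive1E; have [|_ ->//] := dF y.
  by near: y; exact: lt_nbhsr.
have b0 := lt_trans a0 ab.
pose G := gamma_fun (s / alpha).
have Fk x : 0 < x -> derive1 F x = k x.
  by move=> x0; rewrite derive1E; have [_ ->] := dF x x0.
have gt0 x : a <= x <= b -> 0 < x by move=> /andP[+ _]; exact: lt_le_trans.
have sa0 : 0 < s / alpha by rewrite divr_gt0.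
have FE x : 0 < x -> (c * x) `^ alpha / 2 = F x.
  by move=> x0; rewrite /powR gt_eqF ?mulr_gt0// lnM.
have Fincr : {in `[a, b] &, {homo F : x y / x < y}}.
  move=> x y; rewrite !in_itv/= => /gt0 x0 /gt0 y0 xy.
  by rewrite ltr_pM2r ?invr_gt0// ltr_expR ltr_pM2l// ltrD2l ltr_ln.
pose D := 2 `^ (s / alpha) / (alpha * c `^ s).
have D0 : 0 <= D by rewrite divr_ge0 ?powR_ge0// mulr_ge0 ?powR_ge0// ltW.
have HE x : 0 < x -> x `^ (s - 1) * expR (- ((c * x) `^ alpha / 2)) =
    D * (G (F x) * derive1 F x).
  move=> x0; rewrite FE// Fk// /G gamma_funE// expRD /k /D.
  have -> : ln (F x) = alpha * (ln c + ln x) - ln 2.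
    by rewrite /F ln_div ?posrE ?expR_gt0// expRK.
  have powE y r : 0 < y -> y `^ r = expR (r * ln y).
    by move=> y0; rewrite /powR gt_eqF.
  rewrite !powE//.
  have Vx : x^-1 = expR (- ln x) by rewrite expRN lnK.
  have V2 : 2^-1 = expR (- ln 2) :> R by rewrite expRN lnK ?posrE.
  have -> : expR ((s - 1) * ln x) = expR (s / alpha * ln 2) * expR (- (s * ln c)) *
      expR ((s / alpha - 1) * (alpha * (ln c + ln x) - ln 2)) *
      (expR (- ln x) * expR (alpha * (ln c + ln x)) * expR (- ln 2)).
    by rewrite -!expRD; congr expR; field; rewrite gt_eqF.
  rewrite -Vx -V2 [expR (- (s * _))]expRN /F.
  by field; rewrite !gt_eqF ?expR_gt0.
have sub : (\int[mu]_(x in `[F a, F b]) (G x)%:E =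
    \int[mu]_(x in `[a, b]) (((G \o F) * derive1 F) x)%:E)%E.
  apply: integration_by_substitution_increasing => //; first exact: ltW.
  - move=> x; rewrite in_itv/= => /andP[ax xb].
    have x0 : 0 < x by exact: lt_trans ax.
    rewrite /continuous_at Fk//.
    by apply: cvg_trans (ck _ x0); apply: near_eq_cvg; exact: nk.
  - apply/cvg_ex; exists (k a).
    have : k x @[x --> a^'+] --> k a by apply: cvg_at_right_filter; exact: ck.
    apply: cvg_trans; apply: near_eq_cvg; near=> y; rewrite Fk//.
    by apply: lt_trans a0 _; near: y; exact: nbhs_right_gt.
  - apply/cvg_ex; exists (k b).
    have : k x @[x --> b^'-] --> k b by apply: cvg_at_left_filter; exact: ck.
    apply: cvg_trans; apply: near_eq_cvg; near=> y.
    have y0 : 0 < y by near: y; exact: (nbhs_left_gt b0).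
    by rewrite Fk.
  - split.
    + move=> x; rewrite in_itv/= => /andP[ax xb].
      by have [] := dF x (lt_trans a0 ax).
    + by apply: cvg_at_right_filter; exact: is_derive_continuous_at (dF _ a0).
    + by apply: cvg_at_left_filter; exact: is_derive_continuous_at (dF _ b0).
  - apply: continuous_in_subspaceT => y; rewrite inE/= in_itv/= => /andP[Fay _].
    have y0 : 0 < y by exact: lt_le_trans Fay.
    apply: cvgM; first exact: (is_derive_continuous_at (is_derive1_powR _ y0)).
    apply: continuous_cvg; first exact: continuous_expR.
    by apply: cvgN; exact: cvg_id.
have mG : measurable_fun setT G by exact: measurable_gamma_fun.
have G0 x : 0 <= G x by exact: gamma_fun_ge0.
rewrite (_ : (\int[mu]_(x in `[a, b]) _)%E =
    (D%:E * \int[mu]_(x in `[F a, F b]) (G x)%:E)%E); last first.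
  rewrite sub -ge0_integralZl//.
  - by apply: eq_integral => x; rewrite inE/= in_itv/= => /gt0 x0; rewrite HE.
  - apply/measurable_EFinP; apply: (@eq_measurable_fun _ _ _ _ _ (fun x => G (F x) * k x)).
      move=> x; rewrite inE/= in_itv/= => /gt0 x0.
      by rewrite -[RHS]/(G (F x) * derive1 F x) Fk.
    apply: measurable_funTS.
    have mFF : measurable_fun setT F.
      apply: measurable_funM => //; apply: measurableT_comp => //.
      by apply: measurable_funM => //; exact: measurable_funD.
    apply: measurable_funM; first exact: measurableT_comp.
    apply: measurable_funM => //; apply: measurable_funM => //.
    exact: measurable_invr.
  - move=> x; rewrite /= in_itv/= => /gt0 x0.
    rewrite lee_fin -[leRHS]/(G (F x) * derive1 F x) Fk// mulr_ge0//.
    by rewrite /k mulr_ge0 ?(ltW (F0 _))// mulr_ge0 ?invr_ge0 ?ltW.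
rewrite mulrAC -/D [leRHS]EFinM; apply: lee_wpmul2l; first by rewrite lee_fin.
rewrite -Gamma_integral//; apply: ge0_subset_integral => //=.
- by apply: measurable_funTS; exact/measurable_EFinP.
- by move=> x _; rewrite lee_fin.
- by move=> x; rewrite /= !in_itv/= andbT => /andP[+ _]; exact: lt_le_trans.
Unshelve. all: by end_near. Qed.

End GammaIntegral.

(** * Logistic test functions *)

Section Logistic.
Context {R : realType}.
Local Notation mu := (@lebesgue_measure R).
Implicit Types (a b l x y z : R) (p q : {poly R}).

Definition logistic x : R := (1 + expR (- x))^-1.

Let den_gt0 x : 0 < 1 + expR (- x). Proof. by rewrite addr_gt0 ?expR_gt0. Qed.

Lemma logistic_gt0 x : 0 < logistic x. Proof. by rewrite invr_gt0. Qed.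

Lemma logisticN x : logistic (- x) = 1 - logistic x.
Proof.
rewrite /logistic opprK expRN; field.
by rewrite !gt_eqF ?expR_gt0 ?addr_gt0 ?expR_gt0.
Qed.

Lemma logistic_lt1 x : logistic x < 1.
Proof. by rewrite -subr_gt0 -logisticN logistic_gt0. Qed.

Lemma logistic_le_expR x : logistic x <= expR x.
Proof.
rewrite /logistic -[leRHS]invrK -expRN lef_pV2 ?posrE ?expR_gt0//.
by rewrite lerDr.
Qed.

Lemma is_derive_logistic x :
  is_derive x 1 logistic (logistic x * (1 - logistic x)).
Proof.
have n0 : 1 + expR (- x) != 0 by rewrite gt_eqF.
have H : is_derive x 1 (fun x => 1 + expR (- x)) (- expR (- x)).
  by apply: is_derive_eq; rewrite /GRing.scale/=; ring.
have H' := @is_deriveV R (fun x => 1 + expR (- x)) x _ 1 n0 H.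
rewrite /logistic; apply: is_derive_eq.
by rewrite /GRing.scale/=; field.
Qed.

Lemma continuous_logistic : continuous logistic.
Proof. exact: is_derive_continuous is_derive_logistic. Qed.

Lemma cvgy_logistic : logistic x @[x --> +oo] --> (1 : R).
Proof.
have : logistic x @[x --> +oo] --> ((1 + 0)^-1 : R).
  apply: cvgV; first by rewrite addr0 oner_neq0.
  by apply: cvgD; [exact: cvg_cst|exact: cvgr_expR].
by rewrite addr0 invr1.
Qed.

Lemma cvg_natrS : (n.+1%:R : R) @[n --> \oo] --> +oo.
Proof. by have := @cvgr_idn R; rewrite -(cvg_shiftS (fun n => n%:R : R)). Qed.

(** Since [logistic 0 = 1 / 2] agrees with [(1 + sg 0) / 2], the convergence holds at every point,
    the jump included. *)
Lemma cvg_logistic_step z :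
  logistic (n.+1%:R * z) @[n --> \oo] --> (1 + Num.sg z) / 2.
Proof.
have pos y : 0 < y -> logistic (n.+1%:R * y) @[n --> \oo] --> (1 : R).
  move=> y0; apply: (cvg_comp (fun n => n.+1%:R * y) logistic _ cvgy_logistic).
  exact: (cvg_comp (fun n => n.+1%:R) (fun x => x * y) cvg_natrS (gt0_cvgMly y0 cvg_id)).
have [z0|z0|->] := ltrgtP z 0.
- rewrite ltr0_sg// subrr mul0r.
  rewrite (_ : (fun n => logistic _) = (fun n => 1 - logistic (n.+1%:R * - z))); last first.
    by apply/funext => n; rewrite mulrN logisticN subKr.
  have Nz : 0 < - z by rewrite oppr_gt0.
  by have := cvgB (cvg_cst (1 : R)) (pos _ Nz); rewrite subrr => H0; exact: H0.
- by rewrite gtr0_sg// divff//; exact: pos.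
- rewrite sgr0 addr0 mul1r; under eq_fun do rewrite mulr0.
  rewrite /logistic oppr0 expR0; exact: cvg_cst.
Qed.

(** For [n > 0] this is the [n]-th power of [y / n <= exp (y / n)]. *)
Lemma exprn_le_expR (n : nat) y : 0 <= y -> y ^+ n <= n%:R ^+ n * expR y.
Proof.
case: n => [|n] y0; first by rewrite !expr0 mul1r -expR0 ler_expR.
have -> : expR y = expR (y / n.+1%:R) ^+ n.+1.
  by rewrite -expRM_natl mulrC divfK.
rewrite -exprMn lerXn2r ?nnegrE ?mulr_ge0 ?expR_ge0//.
rewrite -ler_pdivrMl// mulrC.
by apply: le_trans (expR_ge1Dx _); rewrite lerDr.
Qed.

(** The product is [S(z) * S(- z)] with [S] the logistic function; one factor is at most 1 and the
    other at most [exp (- |z|)]. *)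
Lemma logistic_decay z : logistic z * (1 - logistic z) <= expR (- `|z|).
Proof.
have S1 := ltW (logistic_lt1 z); have S0 := ltW (logistic_gt0 z).
have [z0|z0] := leP 0 z.
  rewrite ger0_norm// -logisticN; apply: le_trans (logistic_le_expR _).
  by rewrite ler_piMl// ltW// logistic_gt0.
rewrite ltr0_norm// opprK; apply: le_trans (logistic_le_expR _).
by rewrite ler_piMr// gerBl.
Qed.

Definition logistic_density l a x : R :=
  l * (logistic (l * (x - a)) * (1 - logistic (l * (x - a)))).

Lemma logistic_density_ge0 l a x : 0 <= l -> 0 <= logistic_density l a x.
Proof.
move=> l0; rewrite !mulr_ge0// ?subr_ge0; first exact: ltW (logistic_gt0 _).
exact: ltW (logistic_lt1 _).
Qed.

Lemma is_derive_logistic_scaled l a x :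
  is_derive x 1 (fun x => logistic (l * (x - a))) (logistic_density l a x).
Proof.
have H := is_derive_logistic (l * (x - a)).
have H' : is_derive x 1 (fun x => l * (x - a)) l.
  by apply: is_derive_eq; rewrite /GRing.scale/=; ring.
have := @is_derive1_comp R logistic (fun x => l * (x - a)) x _ _ H H'.
by rewrite /logistic_density mulrC.
Qed.

Lemma continuous_logistic_density l a : continuous (logistic_density l a).
Proof.
have c := is_derive_continuous (is_derive_logistic_scaled l a).
move=> x.
apply: cvgM; first exact: cvg_cst.
apply: cvgM; first exact: c.
by apply: cvgB; [exact: cvg_cst|exact: c].
Qed.

Lemma logistic_density_kernel l a : 0 < l ->
  mu.-integrable setT (EFin \o logistic_density l a) /\
  (\int[mu]_x logistic_density l a x)%R = 1.
Proof.
move=> l0; rewrite -[X in _ = X]subr0.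
have affy b : l * (x - b) @[x --> +oo] --> +oo.
  have lV : 0 < l^-1 by rewrite invr_gt0.
  by have := cvgy_affine_div b lV; under eq_fun do rewrite invrK mulrC.
apply: (integral_line_FTC (is_derive_logistic_scaled l a)).
- exact: continuous_logistic_density.
- by move=> x; apply: logistic_density_ge0; exact: ltW.
- apply/cvgNy_compNP.
  rewrite (_ : _ \o _ = (fun x => 1 - logistic (l * (x - - a)))); last first.
    by apply/funext => x /=; rewrite -logisticN; congr logistic; ring.
  have H := cvg_comp _ _ (affy (- a)) cvgy_logistic.
  by have := cvgB (cvg_cst (1 : R)) H; rewrite subrr => H0; exact: H0.
- exact: (cvg_comp _ _ (affy a) cvgy_logistic).
Qed.

(** With [z = l * (x - a)], the left side is at most [z ^ 2 * exp (- |z|) / l], and the 4 is the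
    [2 ^ 2] of [exprn_le_expR]. *)
Lemma logistic_density_tail l a x : 0 < l ->
  logistic_density l a x * (a - x) ^+ 2 <= 4 / l.
Proof.
move=> l0; have ln0 : l != 0 by rewrite gt_eqF.
pose z := l * (x - a).
have -> : logistic_density l a x * (a - x) ^+ 2 =
    z ^+ 2 * (logistic z * (1 - logistic z)) / l.
  by rewrite /logistic_density -/z {3}/z; field.
rewrite ler_wpM2r ?invr_ge0 ?(ltW l0)//.
rewrite (@le_trans _ _ (`|z| ^+ 2 * expR (- `|z|)))//.
  by rewrite real_normK ?num_real// ler_wpM2l ?sqr_ge0// logistic_decay.
rewrite expRN ler_pdivrMr ?expR_gt0// (le_trans (exprn_le_expR 2 (normr_ge0 z)))//.
by rewrite ler_wpM2r ?expR_ge0// -natrX ler_nat.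
Qed.

(* The logistic function S satisfies S' = S * (1 - S), so all derivatives of
   p(S(l * (y - a))) are again polynomials in S(l * (y - a)): this makes differences
   of translates of S explicit Schwartz functions. *)
Definition logistic_deriv_op l p : {poly R} := l *: ('X * (1 - 'X) * p^`()).

Definition logistic_poly_diff l a b p : R -> R := fun y =>
  p.[logistic (l * (y - a))] - p.[logistic (l * (y - b))].

Lemma is_derive_logistic_poly_diff l a b p x :
  is_derive x 1 (logistic_poly_diff l a b p) (logistic_poly_diff l a b (logistic_deriv_op l p) x).
Proof.
have D c : is_derive x 1 (fun y => p.[logistic (l * (y - c))])
    (logistic_deriv_op l p).[logistic (l * (x - c))].
  have := @is_derive1_comp R (horner p) (fun y => logistic (l * (y - c))) x _ _
    (is_derive_poly _ _) (is_derive_logistic_scaled l c x).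
  rewrite /logistic_deriv_op /logistic_density hornerZ !hornerM hornerX.
  rewrite -polyC1 hornerD hornerN hornerC => H.
  by apply: is_derive_eq; rewrite hornerX; ring.
exact: is_deriveB.
Qed.

Lemma derive1n_logistic_poly_diff l a b p m :
  derive1n m (logistic_poly_diff l a b p) =
  logistic_poly_diff l a b (iter m (logistic_deriv_op l) p).
Proof.
elim: m => [|m IH]; first by rewrite derive1n0.
rewrite derive1nS IH; apply/funext => x; rewrite derive1E /=.
by have [_ ->] := is_derive_logistic_poly_diff l a b (iter m (logistic_deriv_op l) p) x.
Qed.

Lemma horner_bounded_unit p : exists C, forall x, 0 <= x <= 1 -> `|p.[x]| <= C.
Proof.
elim/poly_ind: p => [|p c [C HC]]; first by exists 0 => x _; rewrite horner0 normr0.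
exists (C + `|c|) => x x01; rewrite !hornerE (le_trans (ler_normD _ _))// lerD2r normrM.
have /andP[x0 x1] := x01.
by rewrite (le_trans _ (HC x x01))// ler_piMr// ger0_norm.
Qed.

(** Derivatives of the Schwartz functions below are differences of values of one polynomial at two
    points of [[0, 1]]; this bound gives them the decay of the difference of those points. *)
Lemma horner_lipschitz_unit p : exists2 C, 0 <= C & forall x y,
  0 <= x <= 1 -> 0 <= y <= 1 -> `|p.[x] - p.[y]| <= C * `|x - y|.
Proof.
elim/poly_ind: p => [|p c [C C0 HC]].
  by exists 0 => // x y _ _; rewrite !horner0 subrr normr0 mul0r.
have [D HD] := horner_bounded_unit p.
have D0 : 0 <= D by rewrite (le_trans _ (HD 0 _))// lexx ler01.
exists (C + D) => [|x y x01 y01]; first exact: addr_ge0.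
have -> : (p * 'X + c%:P).[x] - (p * 'X + c%:P).[y] =
    (p.[x] - p.[y]) * x + p.[y] * (x - y) by rewrite !hornerE; ring.
rewrite (le_trans (ler_normD _ _))// [leRHS]mulrDl !normrM lerD//.
  have /andP[x0 x1] := x01.
  by rewrite (le_trans _ (HC x y x01 y01))// ler_piMr// ger0_norm.
by rewrite ler_wpM2r// HD.
Qed.

(** Both translates tend to 0 at [-oo] and to 1 at [+oo]. For [y >= 0] the relation
    [S(u) = 1 - S(- u)] turns the difference into one of small terms, so [S(u) <= exp u] serves on
    both sides. *)
Lemma logistic_diff_decay l a b : 0 < l -> exists2 C, 0 <= C &
  forall y, `|logistic (l * (y - a)) - logistic (l * (y - b))| <= C * expR (- (l * `|y|)).
Proof.
move=> l0; pose C := expR (l * a) + expR (l * b) + (expR (- (l * a)) + expR (- (l * b))).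
exists C => [|y]; first by rewrite !addr_ge0 ?expR_ge0.
have [y0|y0] := leP 0 y.
  rewrite (ger0_norm y0) (_ : _ - _ = logistic (- (l * (y - b))) - logistic (- (l * (y - a)))).
    rewrite (le_trans (ler_normB _ _))// !gtr0_norm ?logistic_gt0//.
    rewrite (@le_trans _ _ ((expR (l * a) + expR (l * b)) * expR (- (l * y))))//; last first.
      by rewrite ler_wpM2r ?expR_ge0// lerDl addr_ge0 ?expR_ge0.
    rewrite mulrDl addrC -!expRD lerD//; apply: le_trans (logistic_le_expR _) _;
      by rewrite ler_expR; lra.
  by rewrite !logisticN; ring.
rewrite (ltr0_norm y0) (le_trans (ler_normB _ _))// !gtr0_norm ?logistic_gt0//.
rewrite (@le_trans _ _ ((expR (- (l * a)) + expR (- (l * b))) * expR (- (l * - y))))//; last first.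
  by rewrite ler_wpM2r ?expR_ge0// lerDr addr_ge0 ?expR_ge0.
rewrite mulrDl -!expRD lerD//; apply: le_trans (logistic_le_expR _) _;
  by rewrite ler_expR; lra.
Qed.

Lemma derive1n_cst0 m : derive1n m (fun _ : R => 0 : R) = (fun _ => 0).
Proof.
elim: m => [|m IH]; first by rewrite derive1n0.
by rewrite derive1nS IH; apply/funext => x; exact: derive1_cst.
Qed.

Lemma deriveC_logistic_poly_diff l a b p m x :
  deriveC m (fun y => (logistic_poly_diff l a b p y)%:C) x =
  (logistic_poly_diff l a b (iter m (logistic_deriv_op l) p) x)%:C.
Proof.
rewrite -derive1n_logistic_poly_diff; apply: complexP => //=.
by rewrite derive1n_cst0.
Qed.

Lemma schwartz_logistic_poly_diff l a b p : 0 < l ->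
  schwartz (fun y => (logistic_poly_diff l a b p y)%:C).
Proof.
move=> l0; split.
  move=> m x; split => /=.
    rewrite (_ : (fun y => _) = logistic_poly_diff l a b p)//.
    rewrite derive1n_logistic_poly_diff.
    by have [] := is_derive_logistic_poly_diff l a b (iter m (logistic_deriv_op l) p) x.
  by rewrite derive1n_cst0; exact: derivable_cst.
move=> k m; set q := iter m (logistic_deriv_op l) p.
have [L L0 HL] := horner_lipschitz_unit q.
have [C C0 HC] := logistic_diff_decay a b l0.
exists (k%:R ^+ k / l ^+ k * (L * C)) => x.
rewrite deriveC_logistic_poly_diff -/q normc_real.
have S01 z : 0 <= logistic z <= 1.
  by rewrite (ltW (logistic_gt0 _)) (ltW (logistic_lt1 _)).
have lx : 0 <= l * `|x| by rewrite mulr_ge0// ltW.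
rewrite (@le_trans _ _ (`|x| ^+ k * (L * (C * expR (- (l * `|x|))))))//.
  rewrite ler_wpM2l ?exprn_ge0// (le_trans (HL _ _ (S01 _) (S01 _)))//.
  by rewrite ler_wpM2l.
rewrite (_ : `|x| ^+ k * _ = `|x| ^+ k * expR (- (l * `|x|)) * (L * C)); last by ring.
rewrite ler_wpM2r ?mulr_ge0// expRN ler_pdivrMr ?expR_gt0// mulrAC.
by rewrite ler_pdivlMr ?exprn_gt0// -exprMn [_ * l]mulrC exprn_le_expR.
Qed.

End Logistic.

(** * Primitives in the sense of distributions *)

Section Antiderivative.
Context {R : realType}.
Local Notation mu := (@lebesgue_measure R).
Implicit Types (f g df : R -> R[i]) (T : (R -> R[i]) -> R[i]).

Lemma ReMr (z : R[i]) (r : R) : Re (z * r%:C) = Re z * r.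
Proof. by rewrite ReM /= mulr0 subr0. Qed.

Lemma ImMr (z : R[i]) (r : R) : Im (z * r%:C) = Im z * r.
Proof. by rewrite ImM /= mulr0 add0r. Qed.

Lemma smooth_continuous f : smooth f ->
  continuous (fun x => Re (f x)) /\ continuous (fun x => Im (f x)).
Proof.
move=> sf; split => x; apply: differentiable_continuous; apply/derivable1_diffP;
  by have [] := sf 0%N x.
Qed.

Lemma smooth_cmeasurable f : smooth f -> cmeasurable f.
Proof.
by move=> /smooth_continuous[cRe cIm]; split; exact: continuous_measurable_fun.
Qed.

Lemma approximate_identityC (k : nat -> R -> R) (tau : nat -> R) g (a : R) :
  (forall n x, 0 <= k n x) -> (forall n, mu.-integrable setT (EFin \o k n)) ->
  (forall n, (\int[mu]_x k n x)%R = 1) ->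
  (forall n x, k n x * (a - x) ^+ 2 <= tau n) -> tau n @[n --> \oo] --> 0 ->
  continuous (fun x => Re (g x)) -> continuous (fun x => Im (g x)) ->
  cintegrable mu (fun x => g x * ((1 + (a - x) ^+ 2)^-1)%:C) ->
  cvgC (fun n => cintegral mu (fun x => g x * (k n x)%:C)) (g a).
Proof.
move=> k0 ki k1 ktau tau0 cRe cIm [i1 i2]; split => /=.
  under eq_fun do under eq_Rintegral do rewrite ReMr.
  apply: (approximate_identity k0 ki k1 ktau tau0) => //.
  - exact: continuous_measurable_fun.
  - exact: cRe.
  - by apply: eq_integrable i1 => // x _; rewrite ReMr.
under eq_fun do under eq_Rintegral do rewrite ImMr.
apply: (approximate_identity k0 ki k1 ktau tau0) => //.
- exact: continuous_measurable_fun.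
- exact: cIm.
- by apply: eq_integrable i2 => // x _; rewrite ImMr.
Qed.

(** Half of the mass of [g] to the left of [x] minus half of the mass to the right. This primitive
    is the convolution of [g] with [sgn / 2], the pointwise limit of the arctangent kernels. *)
Definition signed_primitive g (x : R) : R[i] :=
  cintegral mu (fun y => g y * (Num.sg (x - y) / 2)%:C).

(** The sign is the pointwise limit of the continuous functions [2 * logistic (n x) - 1]. *)
Lemma measurable_sgr : measurable_fun setT (fun x : R => Num.sg x).
Proof.
pose h (n : nat) (x : R) := logistic (n.+1%:R * x) * 2 - 1.
have mh n : measurable_fun setT (h n).
  apply: measurable_funB => //; apply: measurable_funM => //.
  apply: (@measurableT_comp _ _ _ _ _ _ logistic) => //.
  by apply: continuous_measurable_fun; exact: continuous_logistic.
apply: (measurable_fun_cvg mh) => x _.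
rewrite (_ : Num.sg x = (1 + Num.sg x) / 2 * 2 - 1); last by field.
apply: cvgB; last exact: cvg_cst.
by apply: cvgM; [exact: cvg_logistic_step|exact: cvg_cst].
Qed.

Lemma normr_half_sgr_le1 (x : R) : `|Num.sg x / 2| <= 1.
Proof.
by rewrite normrM normr_sg ger0_norm//; case: (x != 0); rewrite ?mul1r ?mul0r// invf_le1// ler1n.
Qed.

Lemma cintegrable_signed g (x : R) : cintegrable mu g ->
  cintegrable mu (fun y => g y * (Num.sg (x - y) / 2)%:C).
Proof.
move=> gi; apply: (cintegrable_dominated _ _ (integrable_normc gi)).
  apply: cmeasurableM; first exact: cintegrable_cmeasurable gi.
  apply: cmeasurable_real; apply: measurable_funM => //.
  by apply: measurableT_comp; [exact: measurable_sgr|exact: measurable_funB].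
by move=> y; rewrite normcM normc_real ler_piMr ?normc_ge0// normr_half_sgr_le1.
Qed.

Lemma cvg_divr_natS (C : R) : C / n.+1%:R @[n --> \oo] --> (0 : R).
Proof.
have : C * n.+1%:R^-1 @[n --> \oo] --> C * 0 by apply: cvgM; [exact: cvg_cst|exact: cvg_harmonic].
by rewrite mulr0.
Qed.

(* Testing the distributional identity against the steps S(n(y - q)) - S(n(y - p)),
   whose derivatives are differences of approximate identities at q and p. *)
Lemma distributional_primitive T f df : smooth f -> boundedC f ->
  cintegrable mu df -> represents f T -> represents df (distr_derive T) ->
  forall x y, f x - f y = signed_primitive df x - signed_primitive df y.
Proof.
move=> sf [M fM] dfi fT dfT p q.
have [cRe cIm] := smooth_continuous sf.
have mf := smooth_cmeasurable sf.
have mdf := cintegrable_cmeasurable dfi.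
pose l (n : nat) : R := n.+1%:R.
have l0 n : 0 < l n by rewrite ltr0n.
(* The minus sign of the distributional derivative exchanges the endpoints: with [q] before [p] the
   pairing tends to [f p - f q]. *)
pose r n := logistic_poly_diff (l n) q p 'X.
have rE n y : r n y = logistic (l n * (y - q)) - logistic (l n * (y - p)).
  by rewrite /r /logistic_poly_diff !hornerX.
have srE n y : deriveC 1 (fun y => (r n y)%:C) y =
    (logistic_density (l n) q y - logistic_density (l n) p y)%:C.
  rewrite deriveC_logistic_poly_diff /logistic_poly_diff /logistic_density /=.
  rewrite /logistic_deriv_op derivX mulr1 !hornerZ !hornerM !hornerX !hornerD.
  by rewrite !hornerN !hornerX -polyC1 !hornerC.
have rS n : schwartz (fun y => (r n y)%:C) by exact: schwartz_logistic_poly_diff.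
have r'S n : schwartz (deriveC 1 (fun y => (r n y)%:C)).
  rewrite (_ : deriveC 1 _ = fun y =>
    (logistic_poly_diff (l n) q p (logistic_deriv_op (l n) 'X) y)%:C).
    exact: schwartz_logistic_poly_diff.
  by apply/funext => y; rewrite deriveC_logistic_poly_diff.
have mlog (a b : R) : measurable_fun setT (fun y : R => logistic (a * (y - b))).
  apply: continuous_measurable_fun; exact: is_derive_continuous (is_derive_logistic_scaled a b).
have E n : cintegral mu (fun y => df y * (r n y)%:C) =
    - cintegral mu (fun y => f y * deriveC 1 (fun y => (r n y)%:C) y).
  by rewrite -(dfT _ (rS n)) /distr_derive (fT _ (r'S n)).
have lhs : cvgC (fun n => cintegral mu (fun y => df y * (r n y)%:C))
    (cintegral mu (fun y => df y * ((Num.sg (y - q) - Num.sg (y - p)) / 2)%:C)).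
  apply: (cdominated_convergence _ _ (integrable_normc dfi)).
  - move=> n; apply: cmeasurableM => //; apply: cmeasurable_real.
    rewrite (_ : r n = (fun y => logistic (l n * (y - q)) - logistic (l n * (y - p)))).
      by apply: measurable_funB; exact: mlog.
    by apply/funext => y; rewrite rE.
  - move=> y.
    have H : r n y @[n --> \oo] --> (Num.sg (y - q) - Num.sg (y - p)) / 2.
      under eq_fun do rewrite rE.
      rewrite (_ : (_ - _) / 2 =
        (1 + Num.sg (y - q)) / 2 - (1 + Num.sg (y - p)) / 2); last by field.
      by apply: cvgB; exact: cvg_logistic_step.
    by split; [under eq_fun do rewrite ReMr; rewrite ReMr|
               under eq_fun do rewrite ImMr; rewrite ImMr];
      apply: cvgM => //; exact: cvg_cst.
  - move=> n y; rewrite normcM normc_real ler_piMr ?normc_ge0// rE ler_norml.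
    have := logistic_gt0 (l n * (y - q)); have := logistic_gt0 (l n * (y - p)).
    have := logistic_lt1 (l n * (y - q)); have := logistic_lt1 (l n * (y - p)).
    by lra.
have fk n a : cintegrable mu (fun y => f y * (logistic_density (l n) a y)%:C).
  have [ki _] := logistic_density_kernel a (l0 n).
  have H := integrable_mulr M ki.
  apply: (cintegrable_dominated _ _ H).
    apply: cmeasurableM => //; apply: cmeasurable_real.
    by apply/measurable_EFinP; exact: measurable_int ki.
  move=> y; rewrite normcM normc_real ger0_norm ?logistic_density_ge0 ?(ltW (l0 n))//.
  by rewrite ler_wpM2r ?logistic_density_ge0 ?(ltW (l0 n)).
have rhs a : cvgC (fun n => cintegral mu (fun y => f y * (logistic_density (l n) a y)%:C)) (f a).
  apply: (@approximate_identityC _ (fun n => 4 / l n)) => //.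
  - by move=> n x; apply: logistic_density_ge0; exact: ltW.
  - by move=> n; have [] := logistic_density_kernel a (l0 n).
  - by move=> n; have [] := logistic_density_kernel a (l0 n).
  - by move=> n x; exact: logistic_density_tail.
  - exact: cvg_divr_natS.
  - have H := integrable_mulr M (integrable_inv1Dsqr a).
    apply: (cintegrable_dominated _ _ H).
      apply: cmeasurableM => //; apply: cmeasurable_real.
      by apply/measurable_EFinP; exact: measurable_int (integrable_inv1Dsqr a).
    move=> y; rewrite normcM normc_real ger0_norm ?invr_ge0 ?addr_ge0 ?sqr_ge0//.
    by rewrite ler_wpM2r// invr_ge0 addr_ge0 ?sqr_ge0.
have rhs' := cvgCB (rhs p) (rhs q).
have F n : cintegral mu (fun y => df y * (r n y)%:C) =
    cintegral mu (fun y => f y * (logistic_density (l n) p y)%:C) -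
    cintegral mu (fun y => f y * (logistic_density (l n) q y)%:C).
  rewrite E -opprB -cintegralB//; congr (- _); congr (cintegral _ _); apply/funext => y.
  by rewrite srE raddfB mulrBr.
have lhs' : cvgC (fun n => cintegral mu (fun y => df y * (r n y)%:C)) (f p - f q).
  by under eq_fun do rewrite F.
rewrite (cvgC_unique lhs' lhs) /signed_primitive -cintegralB.
- congr (cintegral _ _); apply/funext => y; rewrite -mulrBr -raddfB /= -mulrBl.
  by congr (_ * (_ / _)%:C); rewrite -(opprB y p) -(opprB y q) !sgrN; ring.
- exact: cintegrable_signed.
- exact: cintegrable_signed.
Qed.

End Antiderivative.

(** * Smoothing on the Fourier side *)

Section SpectralBound.
Context {R : realType}.
Local Notation mu := (@lebesgue_measure R).
Implicit Types (g : R -> R[i]) (m H : R -> R) (x z xi r : R).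

Lemma cmeasurable_comp d d' (T : measurableType d) (T' : measurableType d')
    (f : T' -> R[i]) (h : T -> T') :
  cmeasurable f -> measurable_fun setT h -> cmeasurable (f \o h).
Proof.
by move=> [f1 f2] mh; split; [exact: (measurableT_comp f1 mh)|exact: (measurableT_comp f2 mh)].
Qed.

Lemma cintegral_real d (T : measurableType d) (nu : {measure set T -> \bar R}) (h : T -> R) :
  cintegral nu (fun o => (h o)%:C) = ((\int[nu]_o h o)%R)%:C.
Proof. by apply: complexP => //=; rewrite /Rintegral integral0. Qed.

Lemma cintegrable_real d (T : measurableType d) (nu : {measure set T -> \bar R}) (h : T -> R) :
  nu.-integrable setT (EFin \o h) -> cintegrable nu (fun o => (h o)%:C).
Proof. by move=> hi; split => //=; exact: integrable0. Qed.

Lemma cintegrable_fourier g xi : cintegrable mu g ->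
  cintegrable mu (fun x => cexp ((x * xi)*i) * g x).
Proof.
move=> gi; apply: (cintegrable_dominated _ _ (integrable_normc gi)).
  apply: cmeasurableM; last exact: cintegrable_cmeasurable gi.
  by apply: cmeasurable_cexpi; exact: measurable_funM.
by move=> x; rewrite normcM normc_cexpi mul1r.
Qed.

Lemma normc_fourier_le g xi : cintegrable mu g -> normc (fourier g xi) <= L1norm g.
Proof.
move=> gi; apply: normc_cintegral_le (integrable_normc gi).
  exact: cintegrable_cmeasurable (cintegrable_fourier xi gi).
by move=> x; rewrite normcM normc_cexpi mul1r.
Qed.

(** Measurability in the parameter [xi] is extracted from Fubini, which asks for integrability in
    [xi]. The integrand is therefore multiplied by [h xi = 1 / (1 + xi ^ 2)], and the factor is
    divided out at the end. *)
Lemma cmeasurable_oscillatory d (T : measurableType d)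
    (nu : {sigma_finite_measure set T -> \bar R}) (Z : T -> R) (g : T -> R[i]) :
  measurable_fun setT Z -> cintegrable nu g ->
  cmeasurable (fun xi : R => cintegral nu (fun o => cexp ((Z o * xi)*i) * g o)).
Proof.
move=> mZ gi; pose h xi : R := (1 + (0 - xi) ^+ 2)^-1.
have h0 xi : 0 < 1 + (0 - xi) ^+ 2 by rewrite ltr_pwDl ?sqr_ge0.
have hi : mu.-integrable setT (EFin \o h) by exact: integrable_inv1Dsqr.
have mg := cintegrable_cmeasurable gi.
pose F (xi : R) (o : T) : R[i] := (h xi)%:C * (cexp ((Z o * xi)*i) * g o).
have mh : measurable_fun setT h by apply/measurable_EFinP; exact: measurable_int hi.
have mF : cmeasurable (fun p : R * T => F p.1 p.2).
  apply: cmeasurableM.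
    by apply: cmeasurable_real; exact: measurableT_comp.
  apply: cmeasurableM; last exact: (cmeasurable_comp mg measurable_snd).
  by apply: cmeasurable_cexpi; apply: measurable_funM => //; exact: measurableT_comp.
have Fle xi o : normc (F xi o) <= h xi * normc (g o).
  by rewrite /F !normcM normc_cexpi mul1r normc_real ger0_norm// invr_ge0 ltW.
have H := @cintegrable_fubini_l R _ _ _ _ mu nu F h (fun o => normc (g o)) mF hi
  (integrable_normc gi) Fle.
have ci xi : cintegrable nu (fun o => cexp ((Z o * xi)*i) * g o).
  apply: (cintegrable_dominated _ _ (integrable_normc gi)).
    apply: cmeasurableM => //.
    by apply: cmeasurable_cexpi; exact: measurable_funM.
  by move=> o; rewrite normcM normc_cexpi mul1r.
rewrite (_ : (fun xi => _) = fun xi => (1 + (0 - xi) ^+ 2)%:C * cintegral nu (F xi)).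
  apply: cmeasurableM; last exact: cintegrable_cmeasurable H.
  apply: cmeasurable_real; apply: measurable_funD => //; apply: measurable_funX.
  exact: measurable_funB.
apply/funext => xi; rewrite /F cintegralZl//.
by rewrite mulrA -rmorphM /= /h divff ?gt_eqF// mul1r.
Qed.

Lemma cmeasurable_fourier g : cintegrable mu g -> cmeasurable (fourier g).
Proof. by move=> gi; exact: (@cmeasurable_oscillatory _ _ mu id g). Qed.

Lemma cmeasurable_charfun d (T : measurableType d) (P : probability T R) (Z : T -> R) :
  measurable_fun setT Z ->
  cmeasurable (fun xi => cintegral P (fun o => cexp ((xi * Z o)*i))).
Proof.
move=> mZ; have P1 : cintegrable P (fun _ : T => 1).
  apply: (@cintegrable_real _ _ P (fun _ => 1)).
  exact: finite_measure_integrable_cst.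
rewrite (_ : (fun xi => _) = fun xi => cintegral P (fun o => cexp ((Z o * xi)*i) * 1)).
  exact: cmeasurable_oscillatory.
apply/funext => xi; congr (cintegral _ _); apply/funext => o.
by rewrite mulr1 mulrC.
Qed.

Section weight.
Variables (m : R -> R) (A B : R) (g : R -> R[i]).
Hypotheses (mi : mu.-integrable setT (EFin \o m)) (gi : cintegrable mu g).
Hypothesis AB : A ^+ 2 + B ^+ 2 = 1.

(** [A * cos u + B * sin u] is half of [omega * e^(iu) + omega' * e^(-iu)]. The pair
    [(A, B) = (1, 0)] gives the cosine transform of (a), and [(0, 1)] the sine transform of (b). *)
Let omega : R[i] := A -i* B.
Let omega' : R[i] := A +i* B.

Let normc_omega : normc omega = 1.
Proof. by rewrite normcE /= sqrrN AB sqrtr1. Qed.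
Let normc_omega' : normc omega' = 1.
Proof. by rewrite normcE /= AB sqrtr1. Qed.

(* smoothing is the convolution of g with spectral_kernel, the (co)sine transform of
   the weight m; spectral_fun is its integrand on the Fourier side, where u is either
   the exponential at a point or the characteristic function of a random variable. *)
Definition spectral_fun (u : R -> R[i]) xi : R[i] :=
  (m xi / 2)%:C * ((A -i* B) * fourier g (- xi) * u xi
                   + (A +i* B) * fourier g xi * u (- xi)).

Definition spectral_kernel z : R :=
  (\int[mu]_xi (m xi * (A * cos (z * xi) + B * sin (z * xi))))%R.

Definition smoothing x : R[i] :=
  cintegral mu (fun y => g y * (spectral_kernel (x - y))%:C).

Let mm : measurable_fun setT m.
Proof. by apply/measurable_EFinP; exact: measurable_int mi. Qed.

Let mfg : cmeasurable (fourier g). Proof. exact: cmeasurable_fourier. Qed.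

(** The terms at [xi] and at [- xi] each contribute at most [L1norm g * H xi / 2]; for [|xi| > r]
    both Fourier factors vanish. *)
Lemma normc_spectral_le (u : R -> R[i]) r H :
  cmeasurable u -> mu.-integrable setT (EFin \o H) -> (forall xi, 0 <= H xi) ->
  (forall xi, r < `|xi| -> fourier g xi = 0) ->
  (forall xi, `|xi| <= r -> `|m xi| * normc (u xi) <= H xi /\ `|m xi| * normc (u (- xi)) <= H xi) ->
  normc (cintegral mu (spectral_fun u)) <= L1norm g * (\int[mu]_xi H xi)%R.
Proof.
move=> mu_ Hi H0 fg0 Hle; rewrite -RintegralZl//.
have mN : measurable_fun setT (-%R : R -> R) by [].
have N0 : 0 <= L1norm g by apply: Rintegral_ge0 => x _; exact: normc_ge0.
apply: normc_cintegral_le; last exact: integrable_mulr.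
  apply: cmeasurableM; first by apply: cmeasurable_real; apply: measurable_funM.
  apply: cmeasurableD; apply: cmeasurableM => //.
  - apply: cmeasurableM; first exact: cmeasurable_cst.
    exact: (cmeasurable_comp mfg mN).
  - by apply: cmeasurableM => //; exact: cmeasurable_cst.
  - exact: (cmeasurable_comp mu_ mN).
move=> xi; have [xir|xir] := leP `|xi| r; last first.
  rewrite /spectral_fun !fg0 ?normrN// !mulr0 !mul0r addr0 mulr0 normc0.
  exact: mulr_ge0.
have [H1 H2] := Hle _ xir.
rewrite /spectral_fun normcM normc_real normrM [`|2^-1|]ger0_norm//.
have T : normc (omega * fourier g (- xi) * u xi + omega' * fourier g xi * u (- xi))
    <= L1norm g * normc (u xi) + L1norm g * normc (u (- xi)).
  rewrite (le_trans (normc_triangle _ _))// !normcM normc_omega normc_omega' !mul1r.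
  by rewrite lerD// ler_wpM2r ?normc_ge0// normc_fourier_le.
rewrite (le_trans (ler_wpM2l _ T)) ?mulr_ge0//.
rewrite [leLHS](_ : _ = L1norm g * ((`|m xi| * normc (u xi) + `|m xi| * normc (u (- xi))) / 2));
  last by field.
by rewrite ler_wpM2l//; lra.
Qed.

(** Insert the kernel as an integral over [xi], exchange the integrals, and split the trigonometric
    factor into exponentials: integration over [y] yields [fourier g] at [- xi] and at [xi]. *)
Lemma smoothingE x : smoothing x = cintegral mu (spectral_fun (fun xi => cexp ((xi * x)*i))).
Proof.
pose tau u := A * cos u + B * sin u.
pose F y xi := g y * (m xi * tau ((x - y) * xi))%:C.
have mg := cintegrable_cmeasurable gi.
have mtau : measurable_fun setT tau.
  by apply: measurable_funD; apply: measurable_funM => //; apply: continuous_measurable_fun;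
    [exact: continuous_cos|exact: continuous_sin].
have tau1 u : `|tau u| <= 1.
  have E : tau u ^+ 2 + (A * sin u - B * cos u) ^+ 2 = 1.
    by rewrite -[RHS]mulr1 -{1}AB -(cos2Dsin2 u) /tau; ring.
  rewrite -(ler_pXn2r (ltn0Sn 1)) ?nnegrE// real_normK ?num_real// expr1n -E lerDl.
  exact: sqr_ge0.
have mF : cmeasurable (fun p : R * R => F p.1 p.2).
  apply: cmeasurableM; first exact: cmeasurable_comp.
  apply: cmeasurable_real; apply: measurable_funM; first exact: measurableT_comp.
  apply: measurableT_comp => //; apply: measurable_funM => //.
  exact: measurable_funB.
have Fle y xi : normc (F y xi) <= normc (g y) * `|m xi|.
  rewrite /F normcM normc_real ler_wpM2l ?normc_ge0// normrM ler_piMr//.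
have mtaui z : mu.-integrable setT (EFin \o (fun xi => m xi * tau (z * xi))).
  apply: (integrable_dominated _ _ (integrable_norm mi)).
    by apply: measurable_funM => //; apply: measurableT_comp => //; exact: measurable_funM.
  by move=> xi; rewrite normrM ler_piMr.
have -> : smoothing x = cintegral mu (fun y => cintegral mu (F y)).
  apply: eq_cintegral => y; rewrite /F cintegralZl; last exact: cintegrable_real.
  by rewrite cintegral_real.
rewrite (@cfubini R _ _ _ _ mu mu F (fun y => normc (g y)) (fun xi => `|m xi|) mF
  (integrable_normc gi) (integrable_norm mi) Fle).
apply: eq_cintegral => xi; rewrite /F /spectral_fun.
have ff xi' : cintegrable mu (fun y => cexp ((y * xi')*i) * g y) by exact: cintegrable_fourier.
rewrite (_ : (fun y => _) = fun y =>
  (m xi / 2)%:C * omega * cexp ((xi * x)*i) * (cexp ((y * - xi)*i) * g y) +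
  (m xi / 2)%:C * omega' * cexp ((- xi * x)*i) * (cexp ((y * xi)*i) * g y)).
  rewrite cintegralD; [|exact: cintegrableZl..].
  rewrite !cintegralZl// /fourier mulrDr /omega /omega'.
  by congr (_ + _); rewrite -!mulrA; congr (_ * (_ * _)); rewrite mulrC.
have tauE u : (tau u)%:C = 2^-1%:C * (omega * cexp (u*i) + omega' * cexp ((- u)*i)).
  by apply: complexP; rewrite /= expR0 cosN sinN /tau; field.
apply/funext => y; rewrite rmorphM /= tauE.
have e1 : cexp (((x - y) * xi)*i) = cexp ((xi * x)*i) * cexp ((y * - xi)*i).
  by rewrite -cexpiD; congr (cexp (_*i)); ring.
have e2 : cexp ((- ((x - y) * xi))*i) = cexp ((- xi * x)*i) * cexp ((y * xi)*i).
  by rewrite -cexpiD; congr (cexp (_*i)); ring.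
by rewrite e1 e2 rmorphM /=; ring.
Qed.

(** [spectral_fun] is linear in [u], so taking the expectation replaces the exponential at [Z o] by
    the characteristic function of [Z]. *)
Lemma cintegral_smoothing d (T : measurableType d) (P : probability T R) (Z : T -> R) :
  measurable_fun setT Z ->
  cintegrable P (fun o => smoothing (Z o)) /\
  cintegrable mu (spectral_fun (fun xi => cintegral P (fun o => cexp ((xi * Z o)*i)))) /\
  cintegral P (fun o => smoothing (Z o)) =
  cintegral mu (spectral_fun (fun xi => cintegral P (fun o => cexp ((xi * Z o)*i)))).
Proof.
move=> mZ; pose F xi (o : T) := spectral_fun (fun xi => cexp ((xi * Z o)*i)) xi.
have P1 : P.-integrable setT (EFin \o (fun _ : T => 1 : R)).
  exact: finite_measure_integrable_cst.
have mN : measurable_fun setT (-%R : R -> R) by [].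
have mfgN : cmeasurable (fun xi => fourier g (- xi)) by exact: (cmeasurable_comp mfg mN).
have mF : cmeasurable (fun p : R * T => F p.1 p.2).
  apply: cmeasurableM.
    apply: cmeasurable_real; apply: measurable_funM => //.
    exact: measurableT_comp.
  apply: cmeasurableD; apply: cmeasurableM.
  - apply: cmeasurableM; first exact: cmeasurable_cst.
    exact: (cmeasurable_comp mfgN measurable_fst).
  - apply: cmeasurable_cexpi; apply: measurable_funM => //.
    exact: measurableT_comp.
  - apply: cmeasurableM; first exact: cmeasurable_cst.
    exact: (cmeasurable_comp mfg measurable_fst).
  - apply: cmeasurable_cexpi; apply: measurable_funM => //.
      exact: measurableT_comp.
    exact: measurableT_comp.
have Ni : mu.-integrable setT (EFin \o (fun xi => L1norm g * `|m xi|)).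
  by apply: integrable_mulr; exact: integrable_norm.
have Fle xi o : normc (F xi o) <= L1norm g * `|m xi| * 1.
  rewrite mulr1 /F /spectral_fun normcM normc_real normrM [`|2^-1|]ger0_norm//.
  have T2 : normc (omega * fourier g (- xi) * cexp ((xi * Z o)*i) +
      omega' * fourier g xi * cexp ((- xi * Z o)*i)) <= L1norm g + L1norm g.
    rewrite (le_trans (normc_triangle _ _))// !normcM normc_omega normc_omega'.
    by rewrite !normc_cexpi !mul1r !mulr1 lerD// normc_fourier_le.
  rewrite (le_trans (ler_wpM2l _ T2)) ?mulr_ge0//.
  by rewrite [leLHS](_ : _ = L1norm g * `|m xi|)//; field.
have i1 := @cintegrable_fubini_l R _ _ _ _ mu P F _ _ mF Ni P1 Fle.
have fub := @cfubini R _ _ _ _ mu P F _ _ mF Ni P1 Fle.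
have ci xi : cintegrable P (fun o => cexp ((xi * Z o)*i)).
  apply: (cintegrable_dominated _ _ P1).
    by apply: cmeasurable_cexpi; exact: measurable_funM.
  by move=> o; rewrite normc_cexpi.
have inner xi : cintegral P (F xi) =
    spectral_fun (fun xi => cintegral P (fun o => cexp ((xi * Z o)*i))) xi.
  rewrite /F /spectral_fun cintegralZl; last first.
    by apply: cintegrableD; exact: cintegrableZl.
  by rewrite cintegralD ?cintegralZl//; exact: cintegrableZl.
(* The factors are exchanged to obtain integrability of the smoothing in [o] as well. *)
have mF' : cmeasurable (fun p : T * R => F p.2 p.1).
  exact: (cmeasurable_comp mF (measurable_fun_pair measurable_snd measurable_fst)).
have Fle' o xi : normc (F xi o) <= 1 * (L1norm g * `|m xi|) by rewrite mulrC.
have i2 := @cintegrable_fubini_l R _ _ _ _ P mu (fun o xi => F xi o) _ _ mF' P1 Ni Fle'.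
split.
  rewrite (_ : (fun o => _) = fun o => cintegral mu (F ^~ o))//.
  by apply/funext => o; rewrite smoothingE.
split.
  rewrite (_ : spectral_fun _ = fun xi => cintegral P (F xi))//.
  by apply/funext => xi; rewrite inner.
under eq_cintegral do rewrite smoothingE.
by rewrite -fub; apply: eq_cintegral => xi; rewrite inner.
Qed.

Lemma smoothing_difference_le d1 d2 (T1 : measurableType d1) (T2 : measurableType d2)
    (P1 : probability T1 R) (P2 : probability T2 R) (Z1 : T1 -> R) (Z2 : T2 -> R) r H :
  measurable_fun setT Z1 -> measurable_fun setT Z2 ->
  mu.-integrable setT (EFin \o H) -> (forall xi, 0 <= H xi) ->
  (forall xi, r < `|xi| -> fourier g xi = 0) ->
  (forall xi, `|xi| <= r ->
     `|m xi| * normc (cintegral P1 (fun o => cexp ((xi * Z1 o)*i))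
                      - cintegral P2 (fun o => cexp ((xi * Z2 o)*i))) <= H xi /\
     `|m xi| * normc (cintegral P1 (fun o => cexp ((- xi * Z1 o)*i))
                      - cintegral P2 (fun o => cexp ((- xi * Z2 o)*i))) <= H xi) ->
  normc (cintegral P1 (fun o => smoothing (Z1 o)) - cintegral P2 (fun o => smoothing (Z2 o)))
    <= L1norm g * (\int[mu]_xi H xi)%R.
Proof.
move=> mZ1 mZ2 Hi H0 fg0 Hle.
have [_ [i1 ->]] := cintegral_smoothing P1 mZ1.
have [_ [i2 ->]] := cintegral_smoothing P2 mZ2.
rewrite -cintegralB//.
pose u xi := cintegral P1 (fun o => cexp ((xi * Z1 o)*i))
             - cintegral P2 (fun o => cexp ((xi * Z2 o)*i)).
rewrite (@eq_cintegral _ _ _ mu _ (spectral_fun u)); last first.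
  by move=> xi; rewrite /spectral_fun /u; ring.
have cu : cmeasurable u.
  rewrite (_ : u = fun xi => cintegral P1 (fun o => cexp ((xi * Z1 o)*i))
      + (-1) * cintegral P2 (fun o => cexp ((xi * Z2 o)*i))).
    apply: cmeasurableD; first exact: cmeasurable_charfun.
    by apply: cmeasurableM; [exact: cmeasurable_cst|exact: cmeasurable_charfun].
  by apply/funext => xi; rewrite mulN1r.
exact: (normc_spectral_le cu Hi H0 fg0 Hle).
Qed.

End weight.
End SpectralBound.

(** * Bounds for test functions and their primitives *)

Section TestFunctionBounds.
Context {R : realType}.
Local Notation mu := (@lebesgue_measure R).
Implicit Types (s x y z xi a b : R).

Definition stretched_exp (c alpha s : R) : R -> R :=
  (fun xi => xi `^ (s - 1) * expR (- ((c * xi) `^ alpha / 2))) \_ `]0, +oo[.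

Lemma stretched_exp_ge0 c alpha s xi : 0 <= stretched_exp c alpha s xi.
Proof.
by rewrite /stretched_exp patchE; case: ifP => // _; rewrite mulr_ge0 ?powR_ge0 ?expR_ge0.
Qed.

Lemma stretched_expE c alpha s xi : 0 < xi ->
  stretched_exp c alpha s xi = xi `^ (s - 1) * expR (- ((c * xi) `^ alpha / 2)).
Proof. by move=> xi0; rewrite /stretched_exp patchE mem_set//= in_itv/= xi0. Qed.

Lemma stretched_exp_integral c alpha s : 0 < c -> 0 < alpha -> 0 < s ->
  mu.-integrable setT (EFin \o stretched_exp c alpha s) /\
  (\int[mu]_xi stretched_exp c alpha s xi <=
    2 `^ (s / alpha) * Gamma (s / alpha) / (alpha * c `^ s))%R.
Proof.
move=> c0 al0 s0.
have ms : measurable_fun setT (stretched_exp c alpha s).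
  rewrite /stretched_exp patch_indic; apply: measurable_funM; last exact: measurable_indic.
  apply: measurable_funM => //; apply: measurableT_comp => //; apply: measurableT_comp => //.
  apply: measurable_funM => //.
  by apply: (@measurableT_comp _ _ _ _ _ _ (@powR R ^~ alpha)).
have E : (\int[mu]_xi (stretched_exp c alpha s xi)%:E <=
    (2 `^ (s / alpha) * Gamma (s / alpha) / (alpha * c `^ s))%:E)%E.
  have := stretched_exp_integral_le c0 al0 s0; rewrite integral_mkcond.
  by rewrite -/(stretched_exp c alpha s) restrict_EFin.
have E0 : (0 <= \int[mu]_xi (stretched_exp c alpha s xi)%:E)%E.
  by apply: integral_ge0 => xi _; rewrite lee_fin stretched_exp_ge0.
split.
  apply/integrableP; split; first exact/measurable_EFinP.
  under eq_integral do rewrite /= ger0_norm ?stretched_exp_ge0//.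
  by rewrite (le_lt_trans E) ?ltry.
rewrite -lee_fin /Rintegral fineK// ge0_fin_numE//.
by rewrite (le_lt_trans E) ?ltry.
Qed.

Lemma exp_halfline_le1 (d xi : R) : 0 <= d -> exp_halfline d xi <= 1.
Proof.
move=> d0; rewrite /exp_halfline patchE; case: ifPn => //; rewrite inE/= in_itv/= andbT => xi0.
by rewrite -expR0 ler_expR oppr_le0 mulr_ge0.
Qed.

Lemma poisson_spectral_kernel (d z : R) : 0 < d ->
  spectral_kernel (fun xi => pi^-1 * exp_halfline d xi) 1 0 z
  = d / (pi * (d ^+ 2 + z ^+ 2)).
Proof.
move=> d0; rewrite /spectral_kernel.
under eq_Rintegral do rewrite -mulrA.
have AB : `|1 : R| + `|0 : R| <= 1 by rewrite normr0 addr0 normr1.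
rewrite RintegralZl//; first by rewrite laplace_trig// mul1r mul0r addr0 invfM; ring.
apply: (integrable_dominated _ _ (integrable_exp_halfline d0)).
  apply: measurable_funM; first exact: measurable_exp_halfline.
  apply: measurable_funD; apply: measurable_funM => //.
    exact: measurable_cosM.
  exact: measurable_sinM.
move=> s; rewrite normrM (ger0_norm (exp_halfline_ge0 _ _)) ler_piMr ?exp_halfline_ge0//.
exact: cmp_trig_le1.
Qed.

Lemma atan_spectral_kernel a b z : 0 < a -> a < b ->
  spectral_kernel (fun xi => pi^-1 * sine_weight a b xi) 0 1 z
  = pi^-1 * (atan (b / z) - atan (a / z)).
Proof.
move=> a0 ab; rewrite /spectral_kernel -sine_transform_atan//.
rewrite -RintegralZl//.
  by apply: eq_Rintegral => xi _; rewrite mul0r add0r mul1r mulrA.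
apply: (integrable_dominated _ _ (integrable_sine_weight a0 ab)).
  by apply: measurable_funM; [exact: measurable_sine_weight|exact: measurable_sinM].
move=> xi; have /andP[s0 _] := sine_weight_bounds xi a0 ab.
by rewrite normrM (ger0_norm s0) ler_piMr// ler_norml sin_geN1 sin_le1.
Qed.

Lemma normr_atan_spectral_kernel_le1 a b z : 0 < a -> a < b ->
  `|spectral_kernel (fun xi => pi^-1 * sine_weight a b xi) 0 1 z| <= 1.
Proof.
move=> a0 ab; rewrite atan_spectral_kernel// normrM ger0_norm ?invr_ge0 ?pi_ge0//.
rewrite mulrC ler_pdivrMr ?pi_gt0// mul1r ler_norml.
have := atan_gtNpi2 (b / z); have := atan_ltpi2 (b / z).
have := atan_gtNpi2 (a / z); have := atan_ltpi2 (a / z).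
by lra.
Qed.

Lemma cvg_atan_spectral_kernel z :
  spectral_kernel (fun xi => pi^-1 * sine_weight (n.+2%:R^-1) n.+2%:R xi) 0 1 z
    @[n --> \oo] --> Num.sg z / 2.
Proof.
have n2 n : (n.+2%:R^-1 : R) < n.+2%:R.
  by rewrite (@lt_trans _ _ 1)// ?invf_lt1 ?ltr1n.
have n0 n : 0 < (n.+2%:R^-1 : R) by rewrite invr_gt0.
rewrite (_ : (fun n => _) = fun n =>
  pi^-1 * (atan (n.+2%:R / z) - atan (n.+2%:R^-1 / z))); last first.
  by apply/funext => n; rewrite atan_spectral_kernel.
have pos y : 0 < y ->
    pi^-1 * (atan (n.+2%:R / y) - atan (n.+2%:R^-1 / y)) @[n --> \oo] --> (2^-1 : R).
  move=> y0; have -> : 2^-1 = pi^-1 * (pi / 2 - atan (0 / y)) :> R.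
    by rewrite mul0r atan0 subr0 mulrA mulVf ?mul1r// gt_eqF// pi_gt0.
  apply: cvgM; first exact: cvg_cst.
  apply: cvgB.
    apply: (cvg_comp (fun n => n.+2%:R / y) (@atan R) _ (@cvgy_atan R)).
    have Vy0 : 0 < y^-1 by rewrite invr_gt0.
    have H : (n.+2%:R : R) @[n --> \oo] --> +oo.
      by have := @cvg_natrS R; rewrite -(cvg_shiftS (fun n => n.+1%:R : R)).
    exact: (cvg_comp (fun n => n.+2%:R) (fun x => x * y^-1) H (gt0_cvgMly Vy0 cvg_id)).
  apply: continuous_cvg; first exact: continuous_atan.
  apply: cvgM; last exact: cvg_cst.
  by have := @cvg_harmonic R; rewrite -(cvg_shiftS (@harmonic R)).
have [z0|z0|->] := ltrgtP z 0.
- rewrite ltr0_sg// mulN1r.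
  have Nz0 : 0 < - z by rewrite oppr_gt0.
  rewrite (_ : (fun n => _) = fun n =>
    - (pi^-1 * (atan (n.+2%:R / - z) - atan (n.+2%:R^-1 / - z)))).
    exact: cvgN (pos _ Nz0).
  by apply/funext => n; rewrite invrN !mulrN !atanN; ring.
- by rewrite gtr0_sg// mul1r; exact: pos.
(* At [z = 0] the convention [0^-1 = 0] makes every kernel vanish, in agreement with [sg 0 = 0]. *)
- rewrite sgr0 mul0r; under eq_fun do rewrite invr0 !mulr0 subrr mulr0.
  exact: cvg_cst.
Qed.

Section bounds.
(** In the application [D] is [K1 / t_n ^ (v / alpha)] and [r] is the half-width of the rescaled
    zone of control. *)
Variables (c alpha v r D : R).
Hypotheses (c0 : 0 < c) (alpha0 : 0 < alpha) (v0 : 0 < v) (D0 : 0 <= D).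
Context d1 d2 (T1 : measurableType d1) (T2 : measurableType d2)
  (P1 : probability T1 R) (P2 : probability T2 R) (Z1 : T1 -> R) (Z2 : T2 -> R).
Hypotheses (mZ1 : measurable_fun setT Z1) (mZ2 : measurable_fun setT Z2).
Hypothesis chi_le : forall xi, `|xi| <= r ->
  normc (cintegral P1 (fun o => cexp ((xi * Z1 o)*i))
         - cintegral P2 (fun o => cexp ((xi * Z2 o)*i)))
  <= D * (`|xi| `^ v * expR (- (`|c * xi| `^ alpha / 2))).

(** Common to both parts: a weight below [1 / pi] fits with [s = v + 1], and one below
    [1 / (pi * xi)] with [s = v]. *)
Lemma weighted_charfun_le (m : R -> R) (s : R) :
  (forall xi, xi < 0 -> m xi = 0) ->
  (forall xi, 0 < xi -> `|m xi| * xi `^ v <= pi^-1 * xi `^ (s - 1)) ->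
  forall xi, `|xi| <= r ->
  `|m xi| * normc (cintegral P1 (fun o => cexp ((xi * Z1 o)*i))
                   - cintegral P2 (fun o => cexp ((xi * Z2 o)*i)))
    <= D / pi * stretched_exp c alpha s xi /\
  `|m xi| * normc (cintegral P1 (fun o => cexp ((- xi * Z1 o)*i))
                   - cintegral P2 (fun o => cexp ((- xi * Z2 o)*i)))
    <= D / pi * stretched_exp c alpha s xi.
Proof.
move=> m0 mle.
suff H xi u : `|xi| <= r ->
    u <= D * (`|xi| `^ v * expR (- (`|c * xi| `^ alpha / 2))) ->
    `|m xi| * u <= D / pi * stretched_exp c alpha s xi.
  move=> xi xir; split; apply: H => //; first exact: chi_le.
  by have := @chi_le (- xi); rewrite mulrN !normrN => /(_ xir).
move=> xir ule.
have Dpi0 : 0 <= D / pi by rewrite divr_ge0// pi_ge0.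
rewrite (le_trans (ler_wpM2l _ ule))//.
have [xi0|xi0|->] := ltrgtP xi 0.
- by rewrite m0// normr0 mul0r mulr_ge0// stretched_exp_ge0.
- rewrite (gtr0_norm xi0) (gtr0_norm (mulr_gt0 c0 xi0)) stretched_expE//.
  set e := expR _.
  rewrite (_ : _ * (D * _) = D * e * (`|m xi| * xi `^ v)); last by ring.
  rewrite (_ : D / pi * _ = D * e * (pi^-1 * xi `^ (s - 1))); last by ring.
  by rewrite ler_wpM2l ?mle// mulr_ge0 ?expR_ge0.
(* At the origin the left side is 0 because [v > 0] gives [0 ^ v = 0]. *)
- by rewrite normr0 powR0 ?gt_eqF// mul0r !mulr0 mulr_ge0// stretched_exp_ge0.
Qed.

(** The estimate is proved for the Poisson smoothings of [f] with a bound free of [n], then passed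
    to the limit under both expectations. *)
Lemma test_function_bound (f : R -> R[i]) : smooth f -> cintegrable mu f ->
  (forall xi, r < `|xi| -> fourier f xi = 0) ->
  normc (cintegral P1 (fun o => f (Z1 o)) - cintegral P2 (fun o => f (Z2 o)))
  <= L1norm f * (D / pi * (2 `^ ((v + 1) / alpha) * Gamma ((v + 1) / alpha)
       / (alpha * c `^ (v + 1)))).
Proof.
move=> sf fi ff.
have [cRe cIm] := smooth_continuous sf.
pose d n : R := n.+1%:R^-1.
have d0 n : 0 < d n by rewrite invr_gt0.
pose m n xi : R := pi^-1 * exp_halfline (d n) xi.
have mi n : mu.-integrable setT (EFin \o m n).
  by apply: integrable_mulr; exact: integrable_exp_halfline.
have mle n xi : `|m n xi| <= pi^-1.
  rewrite /m ger0_norm ?mulr_ge0 ?invr_ge0 ?pi_ge0 ?exp_halfline_ge0//.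
  by rewrite ler_piMr ?invr_ge0 ?pi_ge0// exp_halfline_le1// ltW.
have AB : 1 ^+ 2 + 0 ^+ 2 = 1 :> R by rewrite expr1n expr0n addr0.
pose S n := smoothing (m n) 1 0 f.
have N0 : 0 <= L1norm f by apply: Rintegral_ge0 => x _; exact: normc_ge0.
have Sf x : cvgC (S ^~ x) (f x).
  rewrite (_ : S ^~ x = fun n => cintegral mu (fun y => f y *
    (d n / (pi * (d n ^+ 2 + (x - y) ^+ 2)))%:C)); last first.
    apply/funext => n; rewrite /S /smoothing; congr (cintegral _ _); apply/funext => y.
    by rewrite poisson_spectral_kernel.
  apply: (@approximate_identityC _ _ (fun n => d n)) => //.
  - by move=> n y; rewrite divr_ge0 ?(ltW (d0 n))// mulr_ge0 ?pi_ge0// addr_ge0 ?sqr_ge0.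
  - by move=> n; have [] := poisson_kernel x (d0 n).
  - by move=> n; have [] := poisson_kernel x (d0 n).
  (* With [u = (x - y) ^ 2], [pi >= 1] gives [d * u / (pi * (d ^ 2 + u)) <= d], so the width itself
     controls the tail. *)
  - move=> n y; have u0 := sqr_ge0 (x - y); have dd := d0 n.
    have p2 : 2 <= pi :> R by exact: pi_ge2.
    have den : 0 < pi * (d n ^+ 2 + (x - y) ^+ 2).
      by rewrite mulr_gt0 ?pi_gt0// ltr_pwDl ?exprn_gt0.
    rewrite mulrAC ler_pdivrMr// ler_wpM2l ?(ltW dd)//.
    rewrite (@le_trans _ _ (d n ^+ 2 + (x - y) ^+ 2))//; first by rewrite lerDr sqr_ge0.
    rewrite ler_peMl ?addr_ge0 ?sqr_ge0//; lra.
  - exact: cvg_harmonic.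
  - apply: (cintegrable_dominated _ _ (integrable_normc fi)).
      apply: cmeasurableM; first exact: cintegrable_cmeasurable fi.
      apply: cmeasurable_real.
      by apply/measurable_EFinP; exact: measurable_int (integrable_inv1Dsqr x).
    move=> y; rewrite normcM normc_real ler_piMr ?normc_ge0// ger0_norm.
      by rewrite invf_le1 ?lerDl ?sqr_ge0// ltr_pwDl ?sqr_ge0.
    by rewrite invr_ge0 addr_ge0 ?sqr_ge0.
(* As the spectrum of [f] lies in [[- r, r]], this [I] dominates all weights where they matter. It
   bounds the smoothings uniformly in [n] and [x], which gives the constant dominating function
   under the two laws. *)
pose I : R -> R := fun xi => pi^-1 * \1_(`[- r, r]%classic : set R) xi.
have Ii : mu.-integrable setT (EFin \o I).
  by apply: integrable_mulr; exact: integrable_indic_itv.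
have Sle n x : normc (S n x) <= L1norm f * (\int[mu]_xi I xi)%R.
  rewrite /S smoothingE//; apply: (normc_spectral_le _ _ _ _ Ii _ ff) => //.
  - by apply: cmeasurable_cexpi; exact: measurable_funM.
  - by move=> xi; rewrite mulr_ge0 ?invr_ge0 ?pi_ge0// indicE.
  - move=> xi xir; rewrite !normc_cexpi !mulr1.
    suff : `|m n xi| <= I xi by [].
    by rewrite /I indicE mem_set/= ?mulr1 ?in_itv/= -?ler_norml.
have lim d3 (T3 : measurableType d3) (P3 : probability T3 R) (Z3 : T3 -> R) :
    measurable_fun setT Z3 ->
    cvgC (fun n => cintegral P3 (fun o => S n (Z3 o))) (cintegral P3 (fun o => f (Z3 o))).
  move=> mZ3; apply: (@cdominated_convergence _ _ _ _ _ _
    (fun _ => L1norm f * (\int[mu]_xi I xi)%R)) => //.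
  - move=> n; have [+ _] := cintegral_smoothing (mi n) fi AB P3 mZ3.
    exact: cintegrable_cmeasurable.
  - exact: finite_measure_integrable_cst.
apply: (cvgC_normc_le (cvgCB (lim _ _ P1 Z1 mZ1) (lim _ _ P2 Z2 mZ2))) => n.
have v10 : 0 < v + 1 by rewrite addr_gt0.
have [Hi HG] := stretched_exp_integral c0 alpha0 v10.
have Hi' := integrable_mulr (D / pi) Hi.
have H0 xi : 0 <= D / pi * stretched_exp c alpha (v + 1) xi.
  by rewrite mulr_ge0 ?stretched_exp_ge0// divr_ge0// pi_ge0.
rewrite (le_trans (smoothing_difference_le (mi n) fi AB mZ1 mZ2 Hi' H0 ff _))//.
  apply: weighted_charfun_le.
    move=> xi xi0; rewrite /m /exp_halfline patchE memNset ?mulr0//.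
    by rewrite /= in_itv/= andbT leNgt xi0.
  by move=> xi xi0; rewrite addrK ler_wpM2r ?powR_ge0.
by rewrite ler_wpM2l// RintegralZl// ler_wpM2l// divr_ge0// pi_ge0.
Qed.

Lemma primitive_bound (f phi : R -> R[i]) : smooth f -> boundedC f -> cintegrable mu phi ->
  (forall x y, f x - f y = signed_primitive phi x - signed_primitive phi y) ->
  (forall xi, r < `|xi| -> fourier phi xi = 0) ->
  normc (cintegral P1 (fun o => f (Z1 o)) - cintegral P2 (fun o => f (Z2 o)))
  <= L1norm phi * (D / pi * (2 `^ (v / alpha) * Gamma (v / alpha)
       / (alpha * c `^ v))).
Proof.
move=> sf [M fM] phii fE pf.
pose a n : R := n.+2%:R^-1.
have a0 n : 0 < a n by rewrite invr_gt0.
have ab n : a n < n.+2%:R by rewrite (@lt_trans _ _ 1)// ?invf_lt1 ?ltr1n.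
pose m n xi : R := pi^-1 * sine_weight (a n) n.+2%:R xi.
have mi n : mu.-integrable setT (EFin \o m n).
  by apply: integrable_mulr; exact: integrable_sine_weight.
have AB : 0 ^+ 2 + 1 ^+ 2 = 1 :> R by rewrite expr1n expr0n add0r.
pose S n := smoothing (m n) 0 1 phi.
pose V := signed_primitive phi.
have N0 : 0 <= L1norm phi by apply: Rintegral_ge0 => x _; exact: normc_ge0.
have mphi := cintegrable_cmeasurable phii.
have atan_measurable : measurable_fun setT (@atan R).
  by apply: continuous_measurable_fun => x; exact: continuous_atan.
have mk n x : measurable_fun setT (fun y : R => spectral_kernel (m n) 0 1 (x - y)).
  under eq_fun do rewrite atan_spectral_kernel//.
  apply: measurable_funM => //; apply: measurable_funB; apply: measurableT_comp => //;
    apply: measurable_funM => //; apply: measurableT_comp => //; try exact: measurable_invr;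
    exact: measurable_funB.
have kle n x y : normc (phi y * (spectral_kernel (m n) 0 1 (x - y))%:C) <= normc (phi y).
  by rewrite normcM normc_real ler_piMr ?normc_ge0// normr_atan_spectral_kernel_le1.
(* The arctangent kernels are at most 1 in absolute value, so the uniform bound comes from physical
   space, without using the spectrum of [phi]. *)
have Sle n x : normc (S n x) <= L1norm phi.
  apply: normc_cintegral_le (integrable_normc phii) => //.
  by apply: cmeasurableM => //; exact: (cmeasurable_real (mk n x)).
have SV x : cvgC (S ^~ x) (V x).
  apply: (cdominated_convergence _ _ (integrable_normc phii)) => //.
    by move=> n; apply: cmeasurableM => //; exact: (cmeasurable_real (mk n x)).
  move=> y; have H := @cvg_atan_spectral_kernel (x - y).
  by split; [under eq_fun do rewrite ReMr; rewrite ReMr|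
             under eq_fun do rewrite ImMr; rewrite ImMr];
    apply: cvgM => //; exact: cvg_cst.
have lim d3 (T3 : measurableType d3) (P3 : probability T3 R) (Z3 : T3 -> R) :
    measurable_fun setT Z3 ->
    cvgC (fun n => cintegral P3 (fun o => S n (Z3 o))) (cintegral P3 (fun o => V (Z3 o))).
  move=> mZ3; apply: (@cdominated_convergence _ _ _ _ _ _ (fun _ => L1norm phi)) => //.
  - move=> n; have [+ _] := cintegral_smoothing (mi n) phii AB P3 mZ3.
    exact: cintegrable_cmeasurable.
  - exact: finite_measure_integrable_cst.
(* [V - f] is constant, bounded [f] is integrable under any law, and total mass 1 lets the constant
   out of the expectation unchanged. *)
have EV d3 (T3 : measurableType d3) (P3 : probability T3 R) (Z3 : T3 -> R) :
    measurable_fun setT Z3 ->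
    cintegral P3 (fun o => V (Z3 o)) = cintegral P3 (fun o => f (Z3 o)) - (f 0 - V 0).
  move=> mZ3.
  have cst_i (z : R[i]) : cintegrable P3 (fun _ => z).
    by split; exact: finite_measure_integrable_cst.
  have fZi : cintegrable P3 (fun o => f (Z3 o)).
    apply: (@cintegrable_dominated _ _ _ _ _ (fun _ => M)) => //.
      exact: (cmeasurable_comp (smooth_cmeasurable sf) mZ3).
    exact: finite_measure_integrable_cst.
  have cstE (z : R[i]) : cintegral P3 (fun _ => z) = z.
    have PT : fine (P3 setT) = 1 by rewrite probability_setT.
    by apply: complexP; rewrite /= Rintegral_cst// PT mulr1.
  rewrite -[f 0 - V 0]cstE.
  rewrite -cintegralB//; apply: eq_cintegral => o.
  have := fE (Z3 o) 0; rewrite -/V => e.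
  by rewrite -[V _](subrK (V 0)) -e; ring.
have -> : cintegral P1 (fun o => f (Z1 o)) - cintegral P2 (fun o => f (Z2 o)) =
    cintegral P1 (fun o => V (Z1 o)) - cintegral P2 (fun o => V (Z2 o)).
  by rewrite !EV//; ring.
apply: (cvgC_normc_le (cvgCB (lim _ _ P1 Z1 mZ1) (lim _ _ P2 Z2 mZ2))) => n.
have [Hi HG] := stretched_exp_integral c0 alpha0 v0.
have Hi' := integrable_mulr (D / pi) Hi.
have H0 xi : 0 <= D / pi * stretched_exp c alpha v xi.
  by rewrite mulr_ge0 ?stretched_exp_ge0// divr_ge0// pi_ge0.
rewrite (le_trans (smoothing_difference_le (mi n) phii AB mZ1 mZ2 Hi' H0 pf _))//.
  apply: weighted_charfun_le.
    by move=> xi xi0; rewrite /m sine_weight_lt0// mulr0.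
  move=> xi xi0; have /andP[s0 _] := sine_weight_bounds xi (a0 n) (ab n).
  have m0 : 0 <= m n xi by rewrite mulr_ge0 ?invr_ge0 ?pi_ge0.
  rewrite (ger0_norm m0) /m -mulrA.
  rewrite ler_wpM2l ?invr_ge0 ?pi_ge0//.
  have -> : xi `^ (v - 1) = xi^-1 * xi `^ v.
    rewrite powRD ?(gt_eqF xi0) ?implybT//.
    by rewrite powR_inv1 ?(ltW xi0)// mulrC.
  by rewrite ler_wpM2r ?powR_ge0// sine_weight_le_inv.
by rewrite ler_wpM2l// RintegralZl// ler_wpM2l// divr_ge0// pi_ge0.
Qed.

End bounds.
End TestFunctionBounds.

(** * Characteristic functions in the zone of control *)

Section ZoneBound.
Context {R : realType}.
Implicit Types (c alpha beta xi s : R).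

Lemma Re_stable_exponent c alpha beta xi :
  Re (stable_exponent c alpha beta xi) = - `|c * xi| `^ alpha.
Proof. by rewrite /stable_exponent ReM /=; ring. Qed.

Lemma Im_stable_exponent c alpha beta xi :
  Im (stable_exponent c alpha beta xi) =
  `|c * xi| `^ alpha * (beta * stable_h alpha xi * Num.sg xi).
Proof. by rewrite /stable_exponent ImM /=; ring. Qed.

Lemma powR_div_root (x s alpha : R) : 0 < s -> 0 < alpha -> 0 <= x ->
  (x / s `^ (1 / alpha)) `^ alpha = x `^ alpha / s.
Proof.
move=> s0 al0 x0; rewrite powRM// ?invr_ge0 ?powR_ge0//.
rewrite -powRN -powRrM (_ : - (1 / alpha) * alpha = -1) ?powR_inv1 ?(ltW s0)//.
by field; rewrite gt_eqF.
Qed.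

(* The first factor is the drift removed by the normalization when alpha = 1. *)
Lemma stable_exponent_scaling c alpha beta s xi : 0 < c -> 0 < alpha -> 0 < s ->
  cexp (s%:C * stable_exponent c alpha beta (xi / s `^ (1 / alpha))) =
  cexp ((if alpha == 1 then xi * (2 * c * beta / pi * ln s) else 0)*i)
  * cexp (stable_exponent c alpha beta xi).
Proof.
move=> c0 al0 s0; rewrite -cexpD; congr cexp.
have sn0 : s != 0 by rewrite gt_eqF.
have p0 : 0 < s `^ (1 / alpha) by exact: powR_gt0.
have E : `|c * (xi / s `^ (1 / alpha))| `^ alpha = `|c * xi| `^ alpha / s.
  rewrite mulrA normrM normfV (gtr0_norm p0).
  by rewrite powR_div_root.
have sgE : Num.sg (xi / s `^ (1 / alpha)) = Num.sg xi.
  by rewrite sgrM [X in _ * X]gtr0_sg ?mulr1// invr_gt0.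
have := Im_stable_exponent c alpha beta (xi / s `^ (1 / alpha)).
have := Re_stable_exponent c alpha beta (xi / s `^ (1 / alpha)).
have := Im_stable_exponent c alpha beta xi; have := Re_stable_exponent c alpha beta xi.
rewrite E sgE.
case: (stable_exponent c alpha beta xi) => a b.
case: (stable_exponent c alpha beta (xi / _)) => a' b' /= -> -> -> ->.
apply: complexP => /=; first by field.
rewrite mul0r addr0 /stable_h.
(* Only for [alpha = 1] does [stable_h] depend on [|xi|]: the term [- ln s] from [ln (|xi| / s)] is
   the source of the drift. *)
have [al1|_] := eqVneq alpha 1; last by field.
have [->|xi0] := eqVneq xi 0; first by rewrite sgr0 !mul0r !mulr0 addr0.
rewrite al1 divr1 !powRr1 ?(ltW s0)// !normrM normfV.
rewrite (gtr0_norm c0) (gtr0_norm s0) ln_div ?posrE ?normr_gt0//.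
have := numEsg xi; move: (Num.sg xi) (ln `|xi|) => g L.
move: (`|xi|) => N ->.
have pn0 : (pi : R) != 0 by rewrite gt_eqF// pi_gt0.
move: pn0; generalize (pi : R) => p pn0.
by field; rewrite ?sn0 ?pn0.
Qed.

Section zone.
Context (c alpha beta : R) (t : nat -> R)
  (d : nat -> measure_display) (Omega : forall n, measurableType (d n))
  (P : forall n, probability (Omega n) R) (X : forall n, {RV (P n) >-> R}).
Variables (v w gamma K K1 K2 : R).
Hypotheses (c0 : 0 < c) (alpha0 : 0 < alpha).
Hypothesis zone : zone_of_control c alpha beta t X v w gamma K K1 K2.

Local Notation Yn n := (@normalized R c alpha beta t d Omega P X n).

Lemma measurable_normalized n : measurable_fun setT (Yn n).
Proof.
rewrite /normalized; case: (alpha == 1).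
  by apply: measurable_funB => //; exact: measurable_funM.
exact: measurable_funM.
Qed.

(** By scaling, [t_n] times the exponent at [xi / t_n ^ (1 / alpha)] is the exponent at [xi] plus a
    drift phase, which the centering in [normalized] cancels. *)
Lemma charfun_normalized n xi : 0 < t n ->
  cintegral (P n) (fun o => cexp ((xi * Yn n o)*i)) =
  theta c alpha beta t X n (xi / t n `^ (1 / alpha))
  * cexp (stable_exponent c alpha beta xi).
Proof.
move=> tn0; set xi' := xi / _.
have charE : char_function (X n) xi' = theta c alpha beta t X n xi' *
    cexp ((t n)%:C * stable_exponent c alpha beta xi').
  rewrite /theta -mulrA -cexpD mulNr addNr cexp0 mulr1//.
move: charE; rewrite stable_exponent_scaling//.
set D := (if _ then _ else _) => charE.
have -> : theta c alpha beta t X n xi' * cexp (stable_exponent c alpha beta xi) =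
    cexp ((- D)*i) * char_function (X n) xi'.
  have DD : cexp ((- D)*i) * cexp (D*i) = 1 :> R[i].
    by rewrite -cexpiD addNr (_ : 0*i = 0)// cexp0.
  by rewrite charE [RHS]mulrCA [_ * (cexp (D*i) * _)]mulrA DD mul1r.
have ci : cintegrable (P n) (fun o => cexp ((xi' * X n o)*i)).
  have P1 : (P n).-integrable setT (EFin \o (fun _ => 1 : R)).
    exact: finite_measure_integrable_cst.
  apply: (cintegrable_dominated _ _ P1) => [|o]; last by rewrite normc_cexpi.
  by apply: cmeasurable_cexpi; exact: measurable_funM.
rewrite /char_function -cintegralZl//; apply: eq_cintegral => o.
rewrite -cexpiD; congr (cexp (_*i)).
rewrite /normalized /xi' /D; case: eqP => [->|_]; last by ring.
by rewrite divr1 powRr1 ?(ltW tn0)//; ring.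
Qed.

(** This is the purpose of (Z2): the growth allowed by (Z1) consumes at most half of the stable
    decay. After division by [|xi| ^ alpha], the bound on [K] supplies the constant, while
    [gamma * (w - alpha) <= 1] and [t_n >= 1] supply the factor [t_n]. *)
Lemma zone_exponent_le n xi : 1 <= t n ->
  `|xi| <= K * t n `^ gamma ->
  K2 * `|xi| `^ w <= t n * (`|c * xi| `^ alpha / 2).
Proof.
move=> tn1 xir; have tn0 : 0 < t n by exact: lt_le_trans tn1.
have K20 := zone_K2_gt0 zone; have K0 := zone_K_gt0 zone.
have ca0 : 0 < c `^ alpha by exact: powR_gt0.
rewrite normrM (gtr0_norm c0) powRM ?(ltW c0)//.
suff H : K2 * `|xi| `^ (w - alpha) <= t n * (c `^ alpha / 2).
  have [->|xi0] := eqVneq xi 0.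
    rewrite normr0 powR0 ?gt_eqF ?(lt_le_trans alpha0 (zone_alpha_le zone))// mulr0.
    by rewrite powR0 ?gt_eqF// mulr0 mul0r mulr0.
  have -> : w = (w - alpha) + alpha by rewrite subrK.
  rewrite powRD ?normr_eq0 ?xi0 ?implybT//.
  rewrite mulrA [leRHS](_ : _ = t n * (c `^ alpha / 2) * `|xi| `^ alpha); last by ring.
  by rewrite ler_wpM2r ?powR_ge0.
(* If [w = alpha] no power of [|xi|] is left, and the claim reduces to [2 * K2 <= c ^ alpha]
   together with [t_n >= 1]. *)
have := zone_alpha_le zone; rewrite le_eqVlt => /predU1P[aw|aw].
  have := zone_K2_le zone (esym aw); rewrite -aw subrr powRr0 mulr1.
  rewrite ler_pdivlMr ?mulr_gt0// mul1r => H.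
  rewrite (@le_trans _ _ (c `^ alpha / 2))//; first lra.
  by rewrite ler_peMl// divr_ge0// ltW.
have wa0 : 0 < w - alpha by rewrite subr_gt0.
have Kle := zone_K_le zone aw; have gle := zone_gamma_le zone aw.
have KK : K `^ (w - alpha) <= c `^ alpha / (2 * K2).
  have q0 : 0 <= c `^ alpha / (2 * K2) by rewrite divr_ge0 ?(ltW ca0)// mulr_ge0// ltW.
  have := @ge0_ler_powR _ (w - alpha) (ltW wa0) K _ (ltW K0) (powR_ge0 _ _) Kle.
  by rewrite -powRrM mul1r mulVf ?gt_eqF// powRr1.
have tt : (t n `^ gamma) `^ (w - alpha) <= t n.
  rewrite -powRrM -[leRHS]powRr1 ?(ltW tn0)// ler_powR//.
  by rewrite -ler_pdivlMr.
have xx : `|xi| `^ (w - alpha) <= K `^ (w - alpha) * (t n `^ gamma) `^ (w - alpha).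
  rewrite -powRM ?(ltW K0) ?powR_ge0//; apply: (ge0_ler_powR (ltW wa0)) => //.
  by rewrite nnegrE mulr_ge0 ?powR_ge0 ?ltW.
rewrite (le_trans (ler_wpM2l (ltW K20) xx))//.
have : K `^ (w - alpha) * (t n `^ gamma) `^ (w - alpha) <= c `^ alpha / (2 * K2) * t n.
  by rewrite ler_pM ?powR_ge0.
move=> /(ler_wpM2l (ltW K20)) => /le_trans; apply.
rewrite le_eqVlt; apply/orP; left; apply/eqP; field; by rewrite gt_eqF.
Qed.

(** The difference is [theta - 1] at the rescaled frequency times a factor of modulus
    [exp (- |c xi| ^ alpha)]. Half of this decay absorbs the growth of [theta - 1], and rescaling
    [|xi| ^ v] gives [t_n ^ (- v / alpha)]. *)
Lemma zone_charfun_le n xi : 1 <= t n ->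
  `|xi| <= K * t n `^ (gamma + 1 / alpha) ->
  normc (cintegral (P n) (fun o => cexp ((xi * Yn n o)*i))
         - cexp (stable_exponent c alpha beta xi))
  <= K1 / t n `^ (v / alpha) * (`|xi| `^ v * expR (- (`|c * xi| `^ alpha / 2))).
Proof.
move=> tn1 xir; have tn0 : 0 < t n by exact: lt_le_trans tn1.
have p0 : 0 < t n `^ (1 / alpha) by exact: powR_gt0.
rewrite charfun_normalized//; set xi' := xi / _.
have xi'E : `|xi'| = `|xi| / t n `^ (1 / alpha) by rewrite normrM normfV (gtr0_norm p0).
have xi'r : `|xi'| <= K * t n `^ gamma.
  rewrite xi'E ler_pdivrMr// -mulrA -powRD//.
  by rewrite (gt_eqF tn0) implybT.
rewrite -[X in _ - X]mul1r -mulrBl normcM normc_cexp Re_stable_exponent.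
have := @zone_theta _ _ _ _ _ _ _ _ _ _ _ _ _ _ _ zone n xi'.
rewrite in_itv/= -ler_norml => /(_ xi'r) thle.
rewrite (le_trans (ler_wpM2r (expR_ge0 _) thle))//.
have cE : `|c * xi'| `^ alpha = `|c * xi| `^ alpha / t n.
  by rewrite /xi' mulrA normrM normfV (gtr0_norm p0) powR_div_root.
have vE : `|xi'| `^ v = `|xi| `^ v / t n `^ (v / alpha).
  rewrite xi'E powRM ?invr_ge0 ?powR_ge0//; congr (_ * _).
  by rewrite -!powRN -powRrM; congr (_ `^ _); ring.
have := zone_exponent_le tn1 xi'r; rewrite cE vE => ele.
have {}ele : K2 * `|xi'| `^ w <= `|c * xi| `^ alpha / 2.
  by rewrite (le_trans ele)// mulrAC mulrCA divff ?gt_eqF// mulr1.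
rewrite [leRHS](_ : _ = K1 * (`|xi| `^ v / t n `^ (v / alpha)) *
  expR (- (`|c * xi| `^ alpha / 2))); last by ring.
rewrite -[leLHS]mulrA ler_wpM2l ?mulr_ge0 ?invr_ge0 ?powR_ge0 ?(ltW (zone_K1_gt0 zone))//.
by rewrite -expRD ler_expR; lra.
Qed.

End zone.
End ZoneBound.

(** * Transfer to the stable law and the final estimates *)

Lemma cintegral_distribution (R : realType) (d : measure_display) (T : measurableType d)
    (Q : probability T R) (Y : {RV Q >-> R}) (phi : probability R R) (xi : R) :
  distribution Q Y = phi :> (set R -> \bar R) ->
  cintegral Q (fun o => cexp ((xi * Y o)*i)) = cintegral phi (fun x => cexp ((x * xi)*i)).
Proof.
move=> hY.
have Q1 : Q.-integrable setT (EFin \o (fun _ => 1 : R)).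
  exact: finite_measure_integrable_cst.
have H (h : R -> R) : measurable_fun setT h -> (forall x, `|h x| <= 1) ->
    (\int[Q]_o h (xi * Y o) = \int[phi]_x h (x * xi))%R.
  move=> mh h1; congr fine.
  have mhx : measurable_fun setT (fun x : R => h (x * xi)).
    by apply: measurableT_comp => //; exact: measurable_funM.
  have -> : (\int[phi]_x (h (x * xi))%:E = \int[distribution Q Y]_x (h (x * xi))%:E)%E.
    apply: eq_measure_integral => A _ _.
    exact: esym (congr1 (fun m : set R -> \bar R => m A) hY).
  rewrite (@integral_distribution _ _ _ _ _ _ Y (fun x => (h (x * xi))%:E)).
  - by apply: eq_integral => o _ /=; rewrite mulrC.
  - exact/measurable_EFinP.
  - apply: (integrable_dominated _ _ Q1) => //.
    exact: (measurableT_comp mhx).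
apply: complexP => /=.
  rewrite expR0; under eq_Rintegral do rewrite mul1r.
  under [RHS]eq_Rintegral do rewrite mul1r.
  apply: H => [|x]; last by rewrite ler_norml cos_geN1 cos_le1.
  by apply: continuous_measurable_fun; exact: continuous_cos.
rewrite expR0; under eq_Rintegral do rewrite mul1r.
under [RHS]eq_Rintegral do rewrite mul1r.
apply: H => [|x]; last by rewrite ler_norml sin_geN1 sin_le1.
by apply: continuous_measurable_fun; exact: continuous_sin.
Qed.

Lemma fourier_eq0 (R : realType) (f : R -> R[i]) (r xi : R) :
  csupport (fourier f) `<=` `[- r, r] -> r < `|xi| -> fourier f xi = 0.
Proof.
move=> sf; apply: contraTeq => fxi; rewrite -leNgt ler_norml.
have /sf : csupport (fourier f) xi by exact: subset_closure.
by rewrite /= in_itv.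
Qed.

Theorem proposition16 (R : realType) (c alpha beta : R)
  (hc : 0 < c) (halpha : 0 < alpha <= 2) (hbeta : -1 <= beta <= 1)
  (t : nat -> R) (ht_pos : forall n, 0 < t n) (ht : t @ \oo --> +oo)
  (d : nat -> measure_display) (Omega : forall n, measurableType (d n))
  (P : forall n, probability (Omega n) R) (X : forall n, {RV (P n) >-> R})
  (v w gamma K K1 K2 : R) (hv : 0 < v) (hw : 0 < w)
  (hX : zone_of_control c alpha beta t X v w gamma K K1 K2)
  (phi : probability R R)
  (hphi : stable_law c alpha beta phi)
  (d' : measure_display) (Omega' : measurableType d')
  (Q : probability Omega' R) (Y : {RV Q >-> R})
  (hY : distribution Q Y = phi :> (set R -> \bar R)) :
  let Yn := normalized c alpha beta t X in
  let r := fun n => K * t n `^ (gamma + 1 / alpha) in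
  (forall f : nat -> R -> R[i],
     (forall n, test_function (f n)) ->
     (forall n, csupport (fourier (f n)) `<=` `[- r n, r n]) ->
     forall n, 1 <= t n ->
       normc (cintegral (P n) (fun o => f n (Yn n o))
              - cintegral Q (fun o => f n (Y o)))
       <= C0 c alpha v * K1 * (L1norm (f n) / t n `^ (v / alpha)))
  /\
  (forall (T : nat -> (R -> R[i]) -> R[i]) (f df : nat -> R -> R[i]),
     (forall n, test_distribution (T n)) ->
     (forall n, smooth (f n) /\ boundedC (f n)) ->
     (forall n, represents (f n) (T n)) ->
     (forall n, test_function (df n)) ->
     (forall n, represents (df n) (distr_derive (T n))) ->
     (forall n, csupport (fourier (df n)) `<=` `[- r n, r n]) ->
     forall n, 1 <= t n ->
       normc (cintegral (P n) (fun o => f n (Yn n o))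
              - cintegral Q (fun o => f n (Y o)))
       <= C1 c alpha v * K1 * (L1norm (df n) / t n `^ (v / alpha))).
Proof.
move=> Yn r; have /andP[al0 _] := halpha.
have K10 := zone_K1_gt0 hX.
have chi n xi : 1 <= t n -> `|xi| <= r n ->
    normc (cintegral (P n) (fun o => cexp ((xi * Yn n o)*i))
           - cintegral Q (fun o => cexp ((xi * Y o)*i)))
    <= K1 / t n `^ (v / alpha) * (`|xi| `^ v * expR (- (`|c * xi| `^ alpha / 2))).
  move=> tn1 xir; rewrite (cintegral_distribution xi hY) hphi.
  exact: (zone_charfun_le hc al0 hX).
have D0 n : 0 <= K1 / t n `^ (v / alpha) by rewrite divr_ge0 ?powR_ge0// ltW.
have mYn n : measurable_fun setT (Yn n) by exact: measurable_normalized.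
have mY : measurable_fun setT Y by [].
have pn0 : (pi : R) != 0 by rewrite gt_eqF// pi_gt0.
have an0 : alpha != 0 by rewrite gt_eqF.
split.
  move=> f tf sf n tn1; have [fs fi _] := tf n.
  have := test_function_bound hc al0 hv (D0 n) (mYn n) mY (fun xi => @chi n xi tn1) fs fi
    (fun xi => @fourier_eq0 _ _ _ xi (sf n)).
  move=> /le_trans; apply; rewrite le_eqVlt; apply/orP; left; apply/eqP.
  have cn0 : c `^ (v + 1) != 0 by rewrite gt_eqF// powR_gt0.
  have tn0 : t n `^ (v / alpha) != 0 by rewrite gt_eqF// powR_gt0.
  rewrite /C0; move: pn0; generalize (pi : R) => p pn0.
  by field; rewrite tn0 cn0 an0 pn0.
move=> T f df _ fsb fT dfT dfdT sdf n tn1.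
have [fs fb] := fsb n; have [_ dfi _] := dfT n.
have fE := distributional_primitive fs fb dfi (fT n) (dfdT n).
have := primitive_bound hc al0 hv (D0 n) (mYn n) mY (fun xi => @chi n xi tn1) fs fb dfi fE
  (fun xi => @fourier_eq0 _ _ _ xi (sdf n)).
move=> /le_trans; apply; rewrite le_eqVlt; apply/orP; left; apply/eqP.
have cn0 : c `^ v != 0 by rewrite gt_eqF// powR_gt0.
have tn0 : t n `^ (v / alpha) != 0 by rewrite gt_eqF// powR_gt0.
rewrite /C1; move: pn0; generalize (pi : R) => p pn0.
by field; rewrite tn0 cn0 an0 pn0.
Qed.
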